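(* Let $G$ be a t.d.l.c.s.c. group. Then (1) there is a unique maximal closed normal subgroup $\mathrm{Rad}_{\mathscr{E}}(G)$ of $G$ such that $\mathrm{Rad}_{\mathscr{E}}(G)$ is elementary; and (2) there is a unique minimal closed normal subgroup $\mathrm{Res}_{\mathscr{E}}(G)$ of $G$ such that $G/\mathrm{Res}_{\mathscr{E}}(G)$ is elementary. (Maximal and minimal are with respect to inclusion.)
   Context: A t.d.l.c.s.c. group is a totally disconnected locally compact second countable (Hausdorff) topological group. The class $\mathscr{E}$ of elementary groups is the smallest class of t.d.l.c.s.c. groups such that: (i) $\mathscr{E}$ contains all second countable profinite groups and all countable discrete groups; (ii) if $G$ is a t.d.l.c.s.c. group and $H\trianglelefteq G$ is a closed normal subgroup with $H\in\mathscr{E}$ and $G/H$ either profinite or discrete, then $G\in\mathscr{E}$; (iii) if $G$ is a t.d.l.c.s.c. group and $G=\bigcup_{i\in\mathbb{N}}O_i$ where $(O_i)_{i\in\mathbb{N}}$ is an $\subseteq$-increasing sequence of open subgroups of $G$ with $O_i\in\mathscr{E}$ for each $i$, then $G\in\mathscr{E}$. *)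

(* Defs.v *)
From HB Require Import structures.
From mathcomp Require Import all_boot all_classical.
From mathcomp Require Import topology.

Set Implicit Arguments.
Unset Strict Implicit.
Unset Printing Implicit Defensive.

Local Open Scope classical_set_scope.
Local Open Scope quotient_scope.
Local Open Scope group_scope.

HB.structure Definition PreTopologicalGroup := {G of Topological G & Group G}.

HB.mixin Record PreTopologicalGroup_isTopologicalGroup G
    of PreTopologicalGroup G := {
  mul_continuous : continuous (fun x : G * G => x.1 * x.2);
  inv_continuous : continuous (fun x : G => x^-1)
}.

#[short(type="topologicalGroupType")]
HB.structure Definition TopologicalGroup :=
  {G of PreTopologicalGroup G & PreTopologicalGroup_isTopologicalGroup G}.

Section Subgroups.
Variable G : topologicalGroupType.

Definition is_subgroup (H : set G) : Prop :=
  [/\ H 1, forall x y, H x -> H y -> H (x * y) & forall x, H x -> H x^-1].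

Record subgroup := Subgroup {
  subgroup_set :> set G;
  subgroupP : is_subgroup subgroup_set
}.

Record normal_subgroup := NormalSubgroup {
  normal_subgroup_sub :> subgroup;
  normal_subgroupP : forall x g,
    subgroup_set normal_subgroup_sub x ->
    subgroup_set normal_subgroup_sub (x ^ g)
}.

End Subgroups.

(* [set_type] carries the topology induced by the inclusion into [G]. *)
Definition subgroup_type (G : topologicalGroupType) (H : subgroup G) : Type :=
  set_type H.

Section SubgroupTopologicalGroup.
Variables (G : topologicalGroupType) (H : subgroup G).
Local Notation T := (subgroup_type H).

HB.instance Definition _ := Topological.copy T (set_type H).
HB.instance Definition _ := SubChoice.copy T (set_type H).

Lemma subgroup_group_closed : group_closed (fun x => x \in (H : set G)).
Proof.
case: (subgroupP H) => H1 HM HV; split; first exact/mem_set.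
by move=> x y /set_mem Hx /set_mem Hy; apply/mem_set/HM => //; exact: HV.
Qed.

HB.instance Definition _ :=
  SubChoice_isSubGroup.Build G _ T subgroup_group_closed.

Let incl : T -> G := val.

Lemma subgroup_val_continuous : continuous incl.
Proof. exact: (@initial_continuous _ G (set_val : set_type H -> G)). Qed.

Lemma subgroup_continuous (X : topologicalType) (f : X -> T) :
  continuous (incl \o f) -> continuous f.
Proof. exact: (@continuous_comp_initial (set_type H) X G set_val f). Qed.

Lemma subgroup_mul_continuous : continuous (fun x : T * T => x.1 * x.2).
Proof.
apply: subgroup_continuous.
rewrite (_ : _ \o _ = (fun x : T * T => incl x.1 * incl x.2)); last first.
  by apply/funext => x; exact: valM.
move=> x; apply: continuous2_cvg; first exact: (mul_continuous (_, _)).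
- by apply: continuous_comp; [exact: cvg_fst|exact: subgroup_val_continuous].
- by apply: continuous_comp; [exact: cvg_snd|exact: subgroup_val_continuous].
Qed.

Lemma subgroup_inv_continuous : continuous (fun x : T => x^-1).
Proof.
apply: subgroup_continuous.
rewrite (_ : _ \o _ = (fun x : T => (incl x)^-1)); last first.
  by apply/funext => x; exact: gmulfV.
move=> x; apply: continuous_comp; first exact: subgroup_val_continuous.
exact: inv_continuous.
Qed.

HB.instance Definition _ := PreTopologicalGroup_isTopologicalGroup.Build T
  subgroup_mul_continuous subgroup_inv_continuous.

End SubgroupTopologicalGroup.

Section Cosets.
Variables (G : topologicalGroupType) (N : normal_subgroup G).

Definition coset_rel (x y : G) : bool := x^-1 * y \in (N : set G).

Lemma coset_rel_refl : reflexive coset_rel.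
Proof. by move=> x; apply/mem_set; rewrite mulVg; case: (subgroupP N). Qed.

Lemma coset_rel_sym : symmetric coset_rel.
Proof.
have [_ _ NV] := subgroupP N.
by move=> x y; apply/idP/idP => /set_mem/NV; rewrite invgM invgK => /mem_set.
Qed.

Lemma coset_rel_trans : transitive coset_rel.
Proof.
have [_ NM _] := subgroupP N.
move=> y x z /set_mem Nxy /set_mem Nyz; apply/mem_set.
by have := NM _ _ Nxy Nyz; rewrite mulgA mulgK.
Qed.

Canonical coset_equiv :=
  EquivRel coset_rel coset_rel_refl coset_rel_sym coset_rel_trans.

(* G / N, with the quotient topology. *)
Definition quotient_group : Type := quotient_topology {eq_quot coset_equiv}.

HB.instance Definition _ := Topological.on quotient_group.
HB.instance Definition _ := Quotient.on quotient_group.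

Local Notation Q := quotient_group.

Definition quotient_one : Q := \pi_Q 1.
Definition quotient_mul (a b : Q) : Q := \pi_Q (repr a * repr b).
Definition quotient_inv (a : Q) : Q := \pi_Q (repr a)^-1.

Lemma coset_piP x y : \pi_Q x = \pi_Q y <-> (N : set G) (x^-1 * y).
Proof.
split => [/(@eqmodP _ coset_equiv)/set_mem//|Nxy].
exact/(@eqmodP _ coset_equiv)/mem_set.
Qed.

Lemma pi_mul x y : quotient_mul (\pi_Q x) (\pi_Q y) = \pi_Q (x * y).
Proof.
have [N1 NM NV] := subgroupP N; apply/coset_piP.
have /coset_piP Nx : \pi_Q (repr (\pi_Q x)) = \pi_Q x by rewrite reprK.
have /coset_piP Ny : \pi_Q (repr (\pi_Q y)) = \pi_Q y by rewrite reprK.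
move: (repr (\pi_Q x)) (repr (\pi_Q y)) Nx Ny => x' y' Nx Ny.
have -> : (x' * y')^-1 * (x * y) = (x'^-1 * x) ^ y' * (y'^-1 * y).
  by rewrite /conjg invgM !mulgA mulgK.
by apply: NM => //; exact: normal_subgroupP.
Qed.

Lemma pi_inv x : quotient_inv (\pi_Q x) = \pi_Q x^-1.
Proof.
have [N1 NM NV] := subgroupP N; apply/coset_piP.
have /coset_piP Nx : \pi_Q (repr (\pi_Q x)) = \pi_Q x by rewrite reprK.
move: (repr _) Nx => x' Nx.
have -> : x'^-1^-1 * x^-1 = ((x'^-1 * x)^-1) ^ x'^-1.
  by rewrite /conjg invgM !invgK !mulgA mulgK.
by apply: normal_subgroupP; exact: NV.
Qed.

Lemma quotient_mulA : associative quotient_mul.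
Proof.
elim/quotW=> a; elim/quotW=> b; elim/quotW=> c.
by rewrite (pi_mul b c) (pi_mul a b) (pi_mul a) (pi_mul (a * b)) mulgA.
Qed.

Lemma quotient_mul1g : left_id quotient_one quotient_mul.
Proof. by elim/quotW=> a; rewrite pi_mul mul1g. Qed.

Lemma quotient_mulg1 : right_id quotient_one quotient_mul.
Proof. by elim/quotW=> a; rewrite pi_mul mulg1. Qed.

Lemma quotient_mulV : left_inverse quotient_one quotient_inv quotient_mul.
Proof. by elim/quotW=> a; rewrite pi_inv pi_mul mulVg. Qed.

Lemma quotient_mulgV : right_inverse quotient_one quotient_inv quotient_mul.
Proof. by elim/quotW=> a; rewrite pi_inv pi_mul mulgV. Qed.

HB.instance Definition _ := isGroup.Build Q
  quotient_mulA quotient_mul1g quotient_mulg1 quotient_mulV quotient_mulgV.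

Lemma pi_quotient_continuous : continuous (\pi_Q : G -> Q).
Proof. exact: (@pi_continuous G {eq_quot coset_equiv}). Qed.

Lemma mulgl_continuous (n : G) : continuous (fun x : G => x * n).
Proof.
move=> x; apply: continuous2_cvg; first exact: (mul_continuous (_, _)).
- exact: cvg_id.
- exact: cvg_cst.
Qed.

Lemma pi_quotient_open (U : set G) : open U -> open (\pi_Q @` U : set Q).
Proof.
move=> oU; suff oV : open ((\pi_Q : G -> Q) @^-1` (\pi_Q @` U)) by exact: oV.
have [N1 NM NV] := subgroupP N.
rewrite (_ : _ @^-1` _ = \bigcup_(n in (N : set G)) ((fun x => x * n) @^-1` U)).
  apply: bigcup_open => n _; apply: open_comp => // x _.
  exact: mulgl_continuous.
apply/seteqP; split => [x [u Uu /esym/coset_piP Nxu]|x [n Nn Uxn]].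
  by exists (x^-1 * u) => //=; rewrite mulgA mulgV mul1g.
exists (x * n) => //; apply/esym/coset_piP.
by rewrite mulgA mulVg mul1g.
Qed.

Lemma pi_quotient_nbhs (x : G) (U : set G) :
  nbhs x U -> nbhs (\pi_Q x : Q) (\pi_Q @` U).
Proof.
rewrite nbhsE => -[V [oV Vx] VU]; rewrite nbhsE /=.
exists (\pi_Q @` V); last exact: image_subset.
by split; [exact: pi_quotient_open|exists x].
Qed.

Lemma quotient_mul_continuous : continuous (fun x : Q * Q => x.1 * x.2).
Proof.
case; elim/quotW=> x; elim/quotW=> y W /=.
rewrite [_ * _]pi_mul => /pi_quotient_continuous/(mul_continuous (_, _)).
move=> [[U V]] /= [Ux Vy] UVW.
exists (\pi_Q @` U, \pi_Q @` V); first by split; exact: pi_quotient_nbhs.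
move=> [c d] /= [[u Uu <-] [v Vv <-]]; rewrite /= [_ * _]pi_mul.
exact: (UVW (u, v)).
Qed.

Lemma quotient_inv_continuous : continuous (fun x : Q => x^-1).
Proof.
elim/quotW=> x W /=; rewrite [_^-1]pi_inv.
move=> /pi_quotient_continuous/inv_continuous/pi_quotient_nbhs.
by apply: filterS => b [y Wy <-] /=; rewrite [_^-1]pi_inv.
Qed.

HB.instance Definition _ := PreTopologicalGroup_isTopologicalGroup.Build Q
  quotient_mul_continuous quotient_inv_continuous.

End Cosets.

Section Classes.
Variable G : topologicalGroupType.

Definition tdlcsc : Prop :=
  [/\ hausdorff_space G, totally_disconnected [set: G],
      locally_compact [set: G] & @second_countable G].

(* Equivalent to being an inverse limit of finite discrete groups. *)
Definition profinite : Prop :=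
  [/\ compact [set: G], hausdorff_space G & totally_disconnected [set: G]].

Definition discrete_group : Prop := forall A : set G, open A.

End Classes.

(* The least class with the closure properties below; membership is invariant
   under topological isomorphism. Every member is t.d.l.c.s.c.: for the two base
   cases this follows from their hypotheses. *)
Inductive elementary : topologicalGroupType -> Prop :=
| elementary_profinite (G : topologicalGroupType) :
    @second_countable G -> profinite G -> elementary G
| elementary_discrete (G : topologicalGroupType) :
    countable [set: G] -> discrete_group G -> elementary G
| elementary_extension (G : topologicalGroupType) (H : normal_subgroup G) :
    tdlcsc G -> closed (H : set G) -> elementary (subgroup_type H) ->
    profinite (quotient_group H) \/ discrete_group (quotient_group H) ->
    elementary G
| elementary_union (G : topologicalGroupType) (O : nat -> subgroup G) :
    tdlcsc G ->
    (forall i, open (O i : set G)) ->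
    (forall i j, (i <= j)%N -> O i `<=` O j) ->
    [set: G] = \bigcup_i O i ->
    (forall i, elementary (subgroup_type (O i))) ->
    elementary G.

Section Extremal.
Variables (G : topologicalGroupType) (P : normal_subgroup G -> Prop).

Definition is_maximal (R : normal_subgroup G) : Prop :=
  P R /\ forall N : normal_subgroup G, P N -> R `<=` N -> N = R.

Definition is_minimal (R : normal_subgroup G) : Prop :=
  P R /\ forall N : normal_subgroup G, P N -> N `<=` R -> N = R.

End Extremal.

(* Main.v *)
(** Everything rests on the stability of the class of elementary groups under
    injections and quotients.

    If H injects continuously into an elementary group Q, induction on Q reduces
    to Q profinite, where H has open normal subgroups N_n decreasing to 1. For
    a compact open subgroup U the normalisers O_n of N_n `&` U are open and
    increase to H by compactness, and N_n `&` U is a compact open normal subgroup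
    of O_n. Together with extensions this yields: a group mapping to an
    elementary group with elementary kernel is elementary.

    For quotients, one shows by induction on Q that if G = K U with K closed
    normal, U compact open and K injecting into Q, then every quotient of G is
    elementary. The subgroups of K coming from the structure of Q need not be
    normal in G; they are replaced by the intersections of their U-conjugates.
    As K U is open in a general G, it follows that the closure of the image of
    an elementary closed normal subgroup in a quotient of G is elementary.

    The closed normal elementary subgroups are thus stable under joins (the
    preimage in G of the closure of the image of N2 in G / N1), and under closures
    of increasing unions; those with elementary quotient are stable under
    intersections of decreasing sequences. Second countability reduces arbitrary
    families to sequences. *)

Require Import Defs.
From HB Require Import structures.
From mathcomp Require Import all_boot all_classical.
From mathcomp Require Import topology.

Set Implicit Arguments.
Unset Strict Implicit.
Unset Printing Implicit Defensive.

Local Open Scope classical_set_scope.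
Local Open Scope quotient_scope.
Local Open Scope group_scope.

Identity Coercion set_to_fun : set >-> Funclass.

(** * Compactness and van Dantzig's theorem *)

(** If no member of [F] missed [K], the traces on [K] would generate a proper filter, and a cluster
    point of it in [K] would lie in every closed member. *)
Lemma compact_directed_disjoint (T : topologicalType) (K : set T)
    (F : set (set T)) :
  compact K -> F !=set0 -> (forall A B, F A -> F B -> F (A `&` B)) ->
  (forall A, F A -> closed A) -> K `&` \bigcap_(A in F) A = set0 ->
  exists2 A, F A & K `&` A = set0.
Proof.
move=> cK [A0 FA0] FI Fcl K0; apply: contrapT => nex.
have FF : Filter (filter_from F (fun A => K `&` A)).
  apply: filter_from_filter; first by exists A0.
  move=> A B FA FB; exists (A `&` B); first exact: FI.
  by move=> x [Kx [Ax Bx]].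
have PF : ProperFilter (filter_from F (fun A => K `&` A)).
  apply: filter_from_proper => A FA; apply/set0P/eqP => KA.
  by apply: nex; exists A.
have [p [Kp clp]] : K `&` cluster (filter_from F (fun A => K `&` A)) !=set0.
  by apply: cK; exists A0 => // x [].
suff : (K `&` \bigcap_(A in F) A) p by rewrite K0.
split=> // A FA; apply: (Fcl A FA) => V pV.
have [q [[Kq Aq] Vq]] : (K `&` A) `&` V !=set0 by apply: clp => //; exists A.
by exists q.
Qed.

Lemma compact_decreasing_disjoint (T : topologicalType) (K : set T)
    (F : nat -> set T) :
  compact K -> (forall i j, (i <= j)%N -> F j `<=` F i) ->
  (forall n, closed (F n)) -> (forall x, K x -> (forall n, F n x) -> False) ->
  exists n, forall x, K x -> ~ F n x.
Proof.
move=> cK Fdecr Fcl KF.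
have [||||A [n _ <-] KA] := @compact_directed_disjoint _ K (range F) cK.
- by exists (F 0%N); exists 0%N.
- move=> _ _ [i _ <-] [j _ <-]; exists (maxn i j) => //; apply/seteqP; split.
    by move=> x Fx; split; apply: Fdecr Fx; rewrite ?leq_maxl ?leq_maxr.
  by move=> x [Fi Fj]; rewrite /maxn; case: (i < j)%N.
- by move=> _ [n _ <-].
- apply/seteqP; split => // x [Kx Fx]; apply: (KF x) => // n.
  by apply: Fx; exists n.
by exists n => x Kx Fx; have : (K `&` F n) x by []; rewrite KA.
Qed.

Lemma compact_increasing_cover (T : topologicalType) (K : set T)
    (O : nat -> set T) :
  compact K -> (forall i j, (i <= j)%N -> O i `<=` O j) ->
  (forall n, open (O n)) -> K `<=` \bigcup_n O n -> exists n, K `<=` O n.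
Proof.
move=> cK Oincr Oop KO.
have [|||n Kn] := @compact_decreasing_disjoint _ K (fun n => ~` O n) cK.
- by move=> i j ij; apply: subsetC; exact: Oincr.
- by move=> n; exact: open_closedC.
- by move=> x Kx nO; have [n _ Onx] := KO x Kx; exact: (nO n).
by exists n => x Kx; apply: contrapT; exact: Kn.
Qed.

(* In a compact Hausdorff neighbourhood the quasi-component of a point, i.e.
   the intersection of its relatively clopen neighbourhoods, is connected. *)
Lemma trivial_component_compact_open (T : topologicalType) (x : T) :
  hausdorff_space T -> connected_component [set: T] x = [set x] ->
  (exists2 D, nbhs x D & compact D) ->
  forall W, nbhs x W -> exists E, [/\ open E, compact E, E x & E `<=` W].
Proof.
move=> hT cx [D xD cD] W xW.
have [C [xC clC CD]] : exists C, [/\ nbhs x C, closed C & C `<=` D°].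
  have [B xB BD] := @compact_regular T x D hT cD xD D° (nbhs_interior xD).
  exists (closure B); split => //; last exact: closed_closure.
  by apply: (filterS _ xB); exact: subset_closure.
have cC : compact C.
  apply: (subclosed_compact clC cD).
  exact: subset_trans CD (@interior_subset _ D).
pose F (E : set T) := [/\ E x, closed E & exists2 O, open O & E = C `&` O].
have FC : F C.
  split => //; first exact: nbhs_singleton.
  by exists setT; [exact: openT|rewrite setIT].
have FI A B : F A -> F B -> F (A `&` B).
  move=> [Ax clA [O oO AO]] [Bx clB [O' oO' BO']]; split => //.
    exact: closedI.
  exists (O `&` O'); first exact: openI.
  by rewrite AO BO' setIACA setIid.
have Fcl A : F A -> closed A by case.
have sep K : compact K -> K `&` \bigcap_(A in F) A = set0 ->
    exists2 A, F A & K `&` A = set0.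
  by move=> cK; apply: compact_directed_disjoint => //; exists C.
set Q := \bigcap_(A in F) A in sep.
have Qx : Q x by move=> A [].
have QC : Q `<=` C by move=> y; apply.
have clQ : closed Q by apply: closed_bigI.
have connQ : connected Q.
  apply: contrapT => /connectedPn[E [Ene QE [sE1 sE2]]].
  have clE b : closed (E b).
    move=> y clEy; have : Q y.
      apply: clQ; move: clEy; apply: closureS; rewrite QE.
      by case: b => z ?; [right|left].
    rewrite QE; case: b clEy => clEy [] // Ey; exfalso.
    - by suff : (E false `&` closure (E true)) y by rewrite sE2.
    - by suff : (closure (E false) `&` E true) y by rewrite sE1.
  have dE y b : E b y -> E (~~ b) y -> False.
    move=> Ey Ey'; suff : (E false `&` closure (E true)) y by rewrite sE2.
    by case: b Ey Ey' => /= Ey Ey'; split => //; exact: subset_closure.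
  have EQ b : E b `<=` Q by rewrite QE; case: b => z ?; [right|left].
  have QEb b : Q `<=` E b `|` E (~~ b).
    by rewrite QE; case: b => y [] ?; [right|left|left|right].
  have [b Ebx] : exists b, E b x.
    by move: Qx; rewrite QE => -[]; [exists false|exists true].
  have ED : E b `<=` D° by apply: subset_trans CD; exact: subset_trans QC.
  have nE : set_nbhs (E b) (~` E (~~ b)).
    apply/set_nbhsP; exists (~` E (~~ b)); split => //; first exact: closed_openC.
    by move=> y /dE.
  have [V /set_nbhsP[V' [oV' EV' V'V]] VE] :=
    @compact_normal_local T D hT cD (E b) ED (clE b) (~` E (~~ b)) nE.
  have clV' : closure V' `<=` ~` E (~~ b).
    by apply: subset_trans VE; exact: closureS.
  (* The boundary of [V'] in [C] is compact and misses [Q], so some [A] in [F] misses it. Then [A]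
     meets [V'] in a relatively clopen set, a member of [F] that omits the other half of [Q]. *)
  have [||A FA KA] := sep (C `&` (closure V' `\` V')).
  - apply: compact_closedI => //; apply: closedI; first exact: closed_closure.
    exact: open_closedC.
  - apply/seteqP; split => // y [[Cy [Vy nVy]] Qy].
    by have [/EV'|/(clV' _ Vy)] := QEb b y Qy.
  have FAV : F (A `&` V').
    have [Ax clA [O oO AO]] := FA; split.
    - by split => //; exact: EV'.
    - have -> : A `&` V' = A `&` closure V'.
        apply/seteqP; split => y [Ay Vy]; first by split => //; exact: subset_closure.
        split => //; apply: contrapT => nVy.
        by have : (C `&` (closure V' `\` V') `&` A) y;
          [split => //; split => //; move: Ay; rewrite AO => -[]|rewrite KA].
      by apply: closedI => //; exact: closed_closure.
    - by exists (O `&` V'); [exact: openI|rewrite AO setIA].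
  have [y Ey] := Ene (~~ b).
  have [_ V'y] := EQ _ _ Ey _ FAV.
  by apply: (clV' y) => //; exact: subset_closure.
have Q1 : Q `<=` [set x].
  by rewrite -cx; exact: connected_component_max.
have [||A FA KA] := sep (C `&` ~` (C `&` W)°).
- by apply: compact_closedI => //; apply: open_closedC; exact: open_interior.
- apply/seteqP; split => // y [[_ nW] /Q1 yx]; apply: nW; rewrite yx.
  by apply: nbhs_singleton; apply: nbhs_interior; exact: filterI.
have AW : A `<=` (C `&` W)°.
  move=> y Ay; apply: contrapT => nW.
  have : (C `&` ~` (C `&` W)° `&` A) y; last by rewrite KA.
  by split => //; split => //; case: FA Ay => _ _ [O _ ->] [].
have [Ax clA [O oO AO]] := FA.
exists A; split => //.
(* Since [A] lies in the interior of [C], relative openness in [C] is openness in the whole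
   space. *)
- have -> : A = O `&` (C `&` W)°.
    apply/seteqP; split => [y Ay|y [Oy /interior_subset [Cy Wy]]].
      by split; [move: Ay; rewrite AO => -[]|exact: AW].
    by rewrite AO.
  by apply: openI => //; exact: open_interior.
- by apply: (subclosed_compact clA cC); rewrite AO => y [].
- by move=> y /AW /interior_subset[].
Qed.

(** * Countable bases as sequences of open sets *)

Lemma second_countable_seq (T : topologicalType) :
  @second_countable T -> exists b : nat -> set T,
    (forall n, open (b n)) /\
    (forall x W, nbhs x W -> exists n, b n x /\ b n `<=` W).
Proof.
move=> [B /countable_injP[f finj] [Bop Bbase]].
(* At most one member of [B] has code [n]; the union is that member, or empty if there is none. *)
exists (fun n => \bigcup_(V in [set V | B V /\ f V = n]) V); split.
  by move=> n; apply: bigcup_open => V [BV _]; exact: Bop.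
move=> x W /Bbase [V [BV Vx] VW]; exists (f V); split; first by exists V.
move=> y [V' [BV' ff] V'y]; apply: VW; suff -> : V = V' by [].
by apply: finj => //; exact/mem_set.
Qed.

Lemma seq_second_countable (T : topologicalType) (b : nat -> set T) :
  (forall n, open (b n)) ->
  (forall x W, nbhs x W -> exists n, b n x /\ b n `<=` W) ->
  @second_countable T.
Proof.
move=> bop bbase; exists (range b).
  exact: card_le_trans (card_image_le _ _) (countableP _).
split=> [_ [n _ <-]//|x W /bbase [n [bx bW]]].
by exists (b n) => //; split => //; exists n.
Qed.

Lemma nbhs_preimage (S T : topologicalType) (f : S -> T) x (A : set T) :
  continuous f -> nbhs (f x) A -> nbhs x (f @^-1` A).
Proof. by move=> cf; exact: cf. Qed.

(** * Open subgroups, cores and compact open subgroups *)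

Section TopologicalGroups.
Variable G : topologicalGroupType.
Implicit Types (x y z : G) (A W C : set G) (H K U : subgroup G).

Lemma cvgMg (T : Type) (F : set_system T) (FF : Filter F) (f g : T -> G) a b :
  f @ F --> a -> g @ F --> b -> (fun t => f t * g t) @ F --> a * b.
Proof.
by move=> fa gb; apply: continuous2_cvg fa gb; exact: (mul_continuous (a, b)).
Qed.

Lemma cvgVg (T : Type) (F : set_system T) (FF : Filter F) (f : T -> G) a :
  f @ F --> a -> (fun t => (f t)^-1) @ F --> a^-1.
Proof. by move=> fa; apply: (continuous_cvg _ _ fa); exact: inv_continuous. Qed.

Lemma lmulg_continuous a : continuous (fun x : G => a * x).
Proof. by move=> x; apply: cvgMg; [exact: cvg_cst|exact: cvg_id]. Qed.

Lemma conjg_continuous2 : continuous (fun z : G * G => z.1 ^ z.2).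
Proof.
move=> z; apply: cvgMg; first by apply: cvgVg; exact: cvg_snd.
by apply: cvgMg; [exact: cvg_fst|exact: cvg_snd].
Qed.

Lemma conjgl_continuous a : continuous (fun x : G => x ^ a).
Proof.
move=> x; apply: cvgMg; first exact: cvg_cst.
by apply: cvgMg; [exact: cvg_id|exact: cvg_cst].
Qed.

Lemma conjgr_continuous a : continuous (fun x : G => a ^ x).
Proof.
move=> x; apply: cvgMg; first exact: inv_continuous.
by apply: cvgMg; [exact: cvg_cst|exact: cvg_id].
Qed.

Lemma open_lmulg A a : open A -> open [set x | A (a * x)].
Proof. by move=> oA; apply: open_comp => // x _; exact: lmulg_continuous. Qed.

Lemma closed_lmulg A a : closed A -> closed [set x | A (a * x)].
Proof. by move=> oA; apply: preimage_closed => // x _; exact: lmulg_continuous. Qed.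

Lemma subg1 H : H 1. Proof. by case: (subgroupP H). Qed.
Lemma subgM H x y : H x -> H y -> H (x * y).
Proof. by case: (subgroupP H) => _ + _; apply. Qed.
Lemma subgV H x : H x -> H x^-1.
Proof. by case: (subgroupP H) => _ _; apply. Qed.
Lemma subgVr H x : H x^-1 -> H x.
Proof. by move=> /subgV; rewrite invgK. Qed.
Lemma subgMl H x y : H x -> H (x * y) -> H y.
Proof. by move=> Hx /(subgM (subgV Hx)); rewrite mulKg. Qed.
Lemma subgMr H x y : H y -> H (x * y) -> H x.
Proof. by move=> Hy /subgM /(_ (subgV Hy)); rewrite mulgK. Qed.
Lemma subgJ H x y : H x -> H y -> H (x ^ y).
Proof. by move=> Hx Hy; rewrite conjgE; do ?apply: subgM => //; exact: subgV. Qed.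

Lemma nbhs_subgroup_open H : nbhs (1 : G) H -> open (H : set G).
Proof.
move=> nH; rewrite openE => x Hx.
have : nbhs x ((fun y => x^-1 * y) @^-1` H).
  by apply: nbhs_preimage; [exact: lmulg_continuous|rewrite mulVg].
by apply: filterS => y /=; apply: subgMl; exact: subgV.
Qed.

Lemma open_nbhs1 H : open (H : set G) -> nbhs (1 : G) H.
Proof. by move=> oH; apply: open_nbhs_nbhs; split => //; exact: subg1. Qed.

Lemma open_subgroup_closed H : open (H : set G) -> closed (H : set G).
Proof.
move=> oH x clHx; have : nbhs x ((fun y => x^-1 * y) @^-1` H).
  apply: nbhs_preimage; first exact: lmulg_continuous.
  by rewrite mulVg; exact: open_nbhs1.
by move=> /clHx [y [Hy /= Hxy]]; apply/subgVr/(subgMr Hy).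
Qed.

(** A tube argument: conjugation is jointly continuous and fixes 1, so compactness of [C] makes the
    neighbourhood uniform in [c]. *)
Lemma compact_conj_nbhs C W : compact C -> nbhs (1 : G) W ->
  nbhs (1 : G) [set x | forall c, C c -> W (x ^ c)].
Proof.
move=> /compact_near_coveringP cC nW.
apply: (cC G (nbhs (1 : G)) (fun x c => W (x ^ c))) => c _.
have : nbhs ((1 : G) ^ c) W by rewrite conj1g.
move=> /(@conjg_continuous2 ((1 : G), c)) [[A B] /= [A1 Bc] AB].
by exists (B, A) => //= -[b a] [/= Bb Aa]; exact: (AB (a, b)).
Qed.

(** The intersection of the conjugates [c A c^-1] over [c] in [C]. When [C] is a subgroup, it is the
    largest subset of [A] invariant under conjugation by [C]. *)
Definition coreg_set A C : set G := [set x | forall c, C c -> A (x ^ c)].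

Lemma coreg_subproof H C : is_subgroup (coreg_set H C).
Proof.
split=> [c _|x y Hx Hy c Cc|x Hx c Cc]; first by rewrite conj1g; exact: subg1.
- by rewrite conjMg; apply: subgM; [exact: Hx|exact: Hy].
- by rewrite conjVg; apply: subgV; exact: Hx.
Qed.
Definition coreg H C := Subgroup (coreg_subproof H C).

Lemma coreg_sub H U : coreg H U `<=` H.
Proof. by move=> x /(_ 1 (subg1 U)); rewrite conjg1. Qed.

Lemma coregJ H U x u : U u -> coreg H U x -> coreg H U (x ^ u).
Proof. by move=> Uu Hx c Uc; rewrite -conjgM; apply: Hx; exact: subgM. Qed.

Lemma coreg_open H C : compact C -> open (H : set G) -> open (coreg H C : set G).
Proof.
move=> cC oH; apply: nbhs_subgroup_open; apply: compact_conj_nbhs => //.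
exact: open_nbhs1.
Qed.

Lemma coreg_closed H C : closed (H : set G) -> closed (coreg H C : set G).
Proof.
move=> clH; have -> : (coreg H C : set G) =
    \bigcap_(c in C) ((fun x => x ^ c) @^-1` H) by [].
apply: closed_bigI => c _.
by apply: preimage_closed => // x _; exact: conjgl_continuous.
Qed.

Lemma subgI_subproof H K : is_subgroup (H `&` K).
Proof.
split=> [|x y [Hx Kx] [Hy Ky]|x [Hx Kx]]; first by split; exact: subg1.
- by split; exact: subgM.
- by split; exact: subgV.
Qed.
Definition subgI H K := Subgroup (subgI_subproof H K).

(** The subgroup is the stabiliser [E] of [C] under right translations. It lies in [C] because [C]
    contains 1, and a tube argument over the compact [C] shows that it is open. *)
Lemma compact_open_subgroup C : open C -> compact C -> closed C -> C 1 ->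
  exists U : subgroup G, [/\ open (U : set G), compact U & U `<=` C].
Proof.
move=> oC cC clC C1.
pose E := [set x : G | forall a, C a <-> C (a * x)].
have Esub : is_subgroup E.
  split=> [a|x y Ex Ey a|x Ex a]; first by rewrite mulg1.
  - by rewrite mulgA -(Ey (a * x)).
  - by rewrite (Ex (a * x^-1)) mulgVK.
pose U := Subgroup Esub; exists U.
have nA : nbhs (1 : G) [set x | C `<=` [set a | C (a * x)]].
  have /compact_near_coveringP nC := cC.
  apply: (nC G (nbhs (1 : G)) (fun x a => C (a * x))) => a Ca.
  have : nbhs (a * 1) C by rewrite mulg1; exact: open_nbhs_nbhs.
  by move=> /(mul_continuous (a, 1)).
have UC : U `<=` C by move=> x /(_ 1) []; rewrite mul1g => /(_ C1).
have oU : open (U : set G).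
  apply: nbhs_subgroup_open.
  (* The inclusion for [x^-1] supplies the converse implication in the definition of [E]. *)
  have nV : nbhs (1 : G) [set x | C `<=` [set a | C (a * x^-1)]].
    apply: (@nbhs_preimage _ _ (fun x : G => x^-1) 1
      [set x | C `<=` [set a | C (a * x)]]); last by rewrite invg1.
    exact: inv_continuous.
  apply: filterS (filterI nA nV) => x [xA xV] a; split; first exact: xA.
  by move=> /xV /=; rewrite mulgK.
split=> //; apply: (subclosed_compact _ cC UC).
exact: open_subgroup_closed.
Qed.

Theorem van_dantzig W : tdlcsc G -> nbhs (1 : G) W ->
  exists U : subgroup G, [/\ open (U : set G), compact U & U `<=` W].
Proof.
move=> [hG tdG lcG _] nW.
have [D D1 [cD clD]] := lcG 1 I.
have [|C [oC cC C1 CW]] :=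
    @trivial_component_compact_open G 1 hG (tdG 1 I) _ W nW.
  by exists D => //; rewrite withinET in D1.
have [U [oU cU UC]] := compact_open_subgroup oC cC (compact_closed hG cC) C1.
by exists U; split => //; exact: subset_trans CW.
Qed.

(** The cosets [x U] are clopen and compact: they separate points and give compact neighbourhoods.
    This is the criterion by which subgroups and open images are recognised as t.d.l.c.s.c. *)
Lemma compact_open_base_tdlcsc : hausdorff_space G -> @second_countable G ->
  (forall W, nbhs (1 : G) W ->
    exists U : subgroup G, [/\ open (U : set G), compact U & U `<=` W]) ->
  tdlcsc G.
Proof.
move=> hG scG bG; split => //.
- apply: zero_dimension_totally_disconnected => x y xy.
  have [|U [oU cU UW]] := bG (~` [set x^-1 * y]).
    apply: open_nbhs_nbhs; split.
      apply: closed_openC.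
      exact: accessible_closed_set1 (hausdorff_accessible hG) _.
    move=> /= e; move/eqP: xy; apply.
    by rewrite -[y](mulVKg x) -e mulg1.
  exists [set z | U (x^-1 * z)]; split => /=.
  + split; first exact: open_lmulg.
    by apply: closed_lmulg; exact: open_subgroup_closed.
  + by rewrite mulVg; exact: subg1.
  + by move=> /UW; apply.
- move=> x _; have [U [oU cU _]] := bG setT filterT.
  have clU := open_subgroup_closed oU.
  exists [set z | U (x^-1 * z)].
    rewrite withinET; apply: open_nbhs_nbhs; split; first exact: open_lmulg.
    by rewrite /= mulVg; exact: subg1.
  split; last exact: closed_lmulg.
  have -> : [set z | U (x^-1 * z)] = (fun z => x * z) @` U.
    apply/seteqP; split=> [z Uz|_ [z Uz <-]] /=; last by rewrite mulKg.
    by exists (x^-1 * z) => //; rewrite mulVKg.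
  apply: continuous_compact cU; apply: continuous_subspaceT.
  exact: lmulg_continuous.
Qed.

(** Each [V n] is a finite intersection of cores over [U] of open subgroups contained in the basic
    sets around 1. [U] is a set closed under products so that it can be a compact open subgroup or
    the whole of a compact group. *)
Lemma invariant_base (U : set G) : tdlcsc G -> compact U -> U 1 ->
  (forall x y, U x -> U y -> U (x * y)) -> 
  exists V : nat -> subgroup G, [/\ forall n, open (V n : set G),
    forall i j, (i <= j)%N -> V j `<=` V i,
    forall n x u, U u -> V n x -> V n (x ^ u) &
    forall W, nbhs (1 : G) W -> exists n, V n `<=` W].
Proof.
move=> tG cU U1 UM.
have [_ _ _ /second_countable_seq[b [bop bbase]]] := tG.
have exV n : exists V : subgroup G, open (V : set G) /\ (b n 1 -> V `<=` b n).
  have [bn1|nbn1] := pselect (b n 1).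
    have [|V [oV cV Vb]] := @van_dantzig (b n) tG.
      exact: open_nbhs_nbhs.
    by exists V.
  (* For a basic set that does not contain 1 any open subgroup will do. *)
  by have [V [oV _ _]] := van_dantzig tG (@filterT _ _ (nbhs_filter (1 : G)));
    exists V.
have [V VP] := choice exV.
pose V' := fix V' n := if n is m.+1 then subgI (V' m) (coreg (V n) U)
                       else coreg (V 0%N) U.
have V'open n : open (V' n : set G).
  elim: n => [|n IH] /=; first by apply: coreg_open => //; exact: (VP _).1.
  by apply: openI => //; apply: coreg_open => //; exact: (VP _).1.
exists V'; split => //.
- move=> i j; elim: j => [|j IH]; first by rewrite leqn0 => /eqP ->.
  rewrite leq_eqVlt => /predU1P[-> //|/IH VV].
  by move=> x [/VV].
- have cJ n x u : U u -> coreg (V n) U x -> coreg (V n) U (x ^ u).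
    by move=> Uu Vx v Uv; rewrite -conjgM; apply: Vx; exact: UM.
  move=> n x u Uu; elim: n => [|n IH] /=; first exact: cJ.
  by move=> [/IH ? /(cJ _ _ _ Uu)].
- move=> W /bbase [n [bn1 bnW]]; exists n.
  apply: subset_trans bnW; apply: subset_trans ((VP n).2 bn1).
  have cs : coreg (V n) U `<=` V n by move=> x /(_ 1 U1); rewrite conjg1.
  by case: n cs {bn1} => [|n] cs //= x [_ /cs].
Qed.

End TopologicalGroups.

(** * Homomorphisms, subgroups and quotients *)

Lemma subgroup_eq (G : topologicalGroupType) (H K : subgroup G) :
  (H : set G) = K -> H = K.
Proof.
case: H K => [H hH] [K hK] /= HK; rewrite HK in hH *.
by congr Subgroup; exact: Prop_irrelevance.
Qed.

Lemma normal_subgroup_eq (G : topologicalGroupType) (H K : normal_subgroup G) :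
  (H : set G) = K -> H = K.
Proof.
case: H K => [H hH] [K hK] /= /subgroup_eq HK; rewrite HK in hH *.
by congr NormalSubgroup; exact: Prop_irrelevance.
Qed.

Definition hom (G M : topologicalGroupType) (f : G -> M) : Prop :=
  continuous f /\ {morph f : x y / x * y}.

Definition open_map (S T : topologicalType) (f : S -> T) : Prop :=
  forall A, open A -> open (f @` A).

Section Hom.
Variables (G M : topologicalGroupType) (f : G -> M).
Hypothesis hf : hom f.

Lemma hom_continuous : continuous f. Proof. by case: hf. Qed.
Lemma homM x y : f (x * y) = f x * f y. Proof. by case: hf. Qed.
Lemma hom1 : f 1 = 1.
Proof. by apply: (@mulgI _ (f 1)); rewrite -homM !mulg1. Qed.
Lemma homV x : f x^-1 = (f x)^-1.
Proof. by apply: (@mulgI _ (f x)); rewrite -homM !mulgV hom1. Qed.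
Lemma homJ x y : f (x ^ y) = f x ^ f y.
Proof. by rewrite !conjgE !homM homV. Qed.

Lemma ker1_inj : (forall x, f x = 1 -> x = 1) -> injective f.
Proof.
move=> k1 x y fxy; apply: (@mulgI _ x^-1); rewrite mulVg.
by apply/esym/k1; rewrite homM homV fxy mulVg.
Qed.

Lemma preimg_subproof (K : subgroup M) : is_subgroup (f @^-1` K).
Proof.
split=> [|x y /= Kx Ky|x /= Kx] /=; first by rewrite hom1; exact: subg1.
- by rewrite homM; exact: subgM.
- by rewrite homV; exact: subgV.
Qed.
Definition preimg K := Subgroup (preimg_subproof K).

Lemma imageg_subproof (H : subgroup G) : is_subgroup (f @` H).
Proof.
split=> [|_ _ [x Hx <-] [y Hy <-]|_ [x Hx <-]].
- by exists 1; [exact: subg1|exact: hom1].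
- by exists (x * y); [exact: subgM|exact: homM].
- by exists x^-1; [exact: subgV|exact: homV].
Qed.
Definition imageg H := Subgroup (imageg_subproof H).

Lemma preimg_normal (N : normal_subgroup M) x g :
  preimg N x -> preimg N (x ^ g).
Proof. by rewrite /= homJ; exact: normal_subgroupP. Qed.
Definition npreimg N := NormalSubgroup (@preimg_normal N).

Lemma preimg_open (K : subgroup M) : open (K : set M) -> open (preimg K : set G).
Proof. by move=> oK; apply: open_comp => // x _; exact: hom_continuous. Qed.

Lemma preimg_closed (K : subgroup M) :
  closed (K : set M) -> closed (preimg K : set G).
Proof. by move=> oK; apply: preimage_closed => // x _; exact: hom_continuous. Qed.

End Hom.

Lemma compact_image (S T : topologicalType) (f : S -> T) (C : set S) :
  continuous f -> compact C -> compact (f @` C).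
Proof.
by move=> cf; apply: continuous_compact; exact: continuous_subspaceT.
Qed.

Lemma hom_comp (G M L : topologicalGroupType) (f : G -> M) (g : M -> L) :
  hom f -> hom g -> hom (g \o f).
Proof.
move=> hf hg; split=> [x|x y] /=; last by rewrite (homM hf) (homM hg).
by apply: continuous_comp; [exact: hom_continuous|exact: hom_continuous].
Qed.

Lemma hom_id (G : topologicalGroupType) : hom (@id G).
Proof. by split=> // x; exact: cvg_id. Qed.

Lemma trivg_subproof (G : topologicalGroupType) : is_subgroup [set 1 : G].
Proof. by split=> [//|x y -> ->|x ->] /=; rewrite ?mulg1 ?invg1. Qed.
Lemma trivg_normal (G : topologicalGroupType) x g :
  Subgroup (trivg_subproof G) x -> Subgroup (trivg_subproof G) (x ^ g).
Proof. by move=> /= ->; rewrite conj1g. Qed.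
Definition trivg G := NormalSubgroup (@trivg_normal G).

Lemma fullg_subproof (G : topologicalGroupType) : is_subgroup [set: G].
Proof. by []. Qed.
Lemma fullg_normal (G : topologicalGroupType) x g :
  Subgroup (fullg_subproof G) x -> Subgroup (fullg_subproof G) (x ^ g).
Proof. by []. Qed.
Definition fullg G := NormalSubgroup (@fullg_normal G).

Section SubgroupType.
Variables (G : topologicalGroupType) (H : subgroup G).

Definition emb : subgroup_type H -> G := val.

Lemma hom_emb : hom emb.
Proof.
by split=> [|x y]; [exact: subgroup_val_continuous|rewrite /emb valM].
Qed.

Lemma emb_inj : injective emb. Proof. exact: val_inj. Qed.
Lemma emb_in x : H (emb x). Proof. exact: (set_mem (valP x)). Qed.
Lemma emb_surj y : H y -> exists x, emb x = y.
Proof. by move=> Hy; exists (exist _ y (mem_set Hy)). Qed.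

Lemma emb_open (A : set (subgroup_type H)) :
  open A <-> exists2 O, open O & A = emb @^-1` O.
Proof. by split=> [[O oO <-]|[O oO ->]]; exists O. Qed.

Lemma emb_nbhs (x : subgroup_type H) A :
  nbhs x A -> exists O, [/\ open O, O (emb x) & emb @^-1` O `<=` A].
Proof.
rewrite nbhsE => -[B [/emb_open[O oO ->] Ox] BA].
by exists O.
Qed.

Lemma open_map_emb : open (H : set G) -> open_map emb.
Proof.
move=> oH A /emb_open[O oO ->].
have -> : emb @` (emb @^-1` O) = O `&` H.
  apply/seteqP; split=> [_ [x Ox <-]|x [Ox Hx]].
    by split => //; exact: emb_in.
  by have [y yx] := emb_surj Hx; exists y; rewrite //= yx.
exact: openI.
Qed.

Lemma compact_emb_preimage C :
  closed (H : set G) -> compact C -> compact (emb @^-1` C).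
Proof.
move=> clH cC F PF FC.
have [p [[Cp Hp] clp]] : (C `&` H) `&` cluster (emb @ F) !=set0.
  apply: (compact_closedI cC clH); rewrite /= /fmap /=.
  by apply: filterS FC => x Cx; split => //; exact: emb_in.
have [q qp] := emb_surj Hp; exists q; split; first by rewrite /= qp.
move=> A B FA /emb_nbhs[O [oO Oq OB]].
have [_ [[x Ax <-] Ox]] : (emb @` A) `&` O !=set0.
  apply: clp; last by apply: open_nbhs_nbhs; split => //; rewrite -qp.
  by apply: (@filterS _ F _ A) FA => x Ax; exists x.
by exists x; split => //; exact: OB.
Qed.

Section Lift.
Variables (X : Type) (f : X -> G).
Hypothesis fH : forall x, H (f x).
Definition lift (x : X) : subgroup_type H := exist _ (f x) (mem_set (fH x)).
Lemma emb_lift x : emb (lift x) = f x. Proof. by []. Qed.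
Lemma lift_inj : injective f -> injective lift.
Proof. by move=> fi x y /(congr1 emb); rewrite !emb_lift => /fi. Qed.
End Lift.

Lemma hom_lift (X : topologicalGroupType) (f : X -> G) (fH : forall x, H (f x)) :
  hom f -> hom (lift fH).
Proof.
move=> hf; split; last first.
  move=> x y; apply: emb_inj.
  by rewrite (homM hom_emb) !emb_lift (homM hf).
by apply: subgroup_continuous; exact: hom_continuous.
Qed.

End SubgroupType.

Section Quotient.
Variables (G : topologicalGroupType) (N : normal_subgroup G).

Definition cmap (x : G) : quotient_group N := \pi_(quotient_group N) x.

Lemma hom_cmap : hom cmap.
Proof.
split; first exact: pi_quotient_continuous.
by move=> x y; rewrite /cmap -pi_mul.
Qed.

Lemma open_map_cmap : open_map cmap.
Proof. by move=> A; exact: pi_quotient_open. Qed.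

Lemma cmap_surj y : exists x, cmap x = y.
Proof. by exists (repr y); rewrite /cmap reprK. Qed.

Lemma cmap1P x : cmap x = 1 <-> N x.
Proof.
rewrite -(hom1 hom_cmap); split=> [/esym/coset_piP|Nx].
  by rewrite invg1 mul1g.
by apply/esym/coset_piP; rewrite invg1 mul1g.
Qed.

Lemma cmap_eqP x y : cmap x = cmap y <-> N (x^-1 * y).
Proof. exact: coset_piP. Qed.

End Quotient.

(** * Stability of t.d.l.c.s.c. groups under closed subgroups and quotients *)

Lemma closed1_hausdorff (G : topologicalGroupType) :
  closed [set 1 : G] -> hausdorff_space G.
Proof.
move=> cl1 p q clpq; apply: contrapT => npq.
have : nbhs (p^-1 * q) (~` [set 1]).
  apply: open_nbhs_nbhs; split; first exact: closed_openC.
  by move=> /= e; apply: npq; rewrite -[q](mulVKg p) e mulg1.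
have : (fun z : G * G => z.1^-1 * z.2) @ (p, q) --> p^-1 * q.
  by apply: cvgMg; [apply: cvgVg; exact: cvg_fst|exact: cvg_snd].
move=> /[apply] -[[A B] /= [pA qB] AB].
have [z [Az Bz]] := clpq A B pA qB.
by apply: (AB (z, z)) => //=; rewrite mulVg.
Qed.

Lemma hausdorff_closed1 (G : topologicalGroupType) :
  hausdorff_space G -> closed [set 1 : G].
Proof. by move=> hG; exact: accessible_closed_set1 (hausdorff_accessible hG) _. Qed.

Lemma tdlcsc_closed1 (G : topologicalGroupType) : tdlcsc G -> closed [set 1 : G].
Proof. by case=> hG _ _ _; exact: hausdorff_closed1. Qed.

Lemma injective_hausdorff (S T : topologicalType) (f : S -> T) :
  continuous f -> injective f -> hausdorff_space T -> hausdorff_space S.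
Proof.
move=> cf fi hT p q clpq; apply/fi/hT => A B pA qB.
have [x [Ax Bx]] := clpq _ _ (nbhs_preimage cf pA) (nbhs_preimage cf qB).
by exists (f x).
Qed.

Lemma tdlcsc_subgroup (G : topologicalGroupType) (H : subgroup G) :
  tdlcsc G -> closed (H : set G) -> tdlcsc (subgroup_type H).
Proof.
move=> tG clH; have [hG _ _ scG] := tG.
have ci := hom_continuous (hom_emb H).
apply: compact_open_base_tdlcsc.
- exact: injective_hausdorff ci (@emb_inj _ _) hG.
- have [b [bop bbase]] := second_countable_seq scG.
  apply: (@seq_second_countable _ (fun n => @emb _ H @^-1` b n)).
    by move=> n; apply/emb_open; exists (b n).
  move=> x W /emb_nbhs[O [oO Ox OW]].
  have [n [bx bO]] := bbase _ _ (open_nbhs_nbhs (conj oO Ox)).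
  by exists n; split => //; apply: subset_trans OW => y /bO.
- move=> W /emb_nbhs[O [oO O1 OW]].
  have [|U [oU cU UO]] := @van_dantzig G O tG.
    by apply: open_nbhs_nbhs; split => //; rewrite -(hom1 (hom_emb H)).
  exists (preimg (hom_emb H) U); split.
  + exact: preimg_open.
  + exact: compact_emb_preimage.
  + by apply: subset_trans OW => y /UO.
Qed.

(** An open continuous surjection carries a countable base to a countable base and compact open
    subgroups to compact open subgroups. *)
Lemma tdlcsc_image (G M : topologicalGroupType) (f : G -> M) :
  hom f -> open_map f -> (forall y, exists x, f x = y) -> tdlcsc G ->
  closed [set 1 : M] -> tdlcsc M.
Proof.
move=> hf of_ fs tG cl1; have [_ _ _ scG] := tG.
have cf := hom_continuous hf.
apply: compact_open_base_tdlcsc; first exact: closed1_hausdorff.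
- have [b [bop bbase]] := second_countable_seq scG.
  apply: (@seq_second_countable _ (fun n => f @` b n)).
    by move=> n; exact: of_.
  move=> y W; have [x <-] := fs y => /(nbhs_preimage cf) /bbase[n [bx bW]].
  exists n; split; first by exists x.
  by move=> _ [z bz <-]; exact: bW.
- move=> W; rewrite -(hom1 hf) => /(nbhs_preimage cf).
  move=> /(van_dantzig tG)[U [oU cU UW]]; exists (imageg hf U); split.
  + exact: of_.
  + exact: compact_image.
  + by move=> _ [x Ux <-]; exact: UW.
Qed.

Lemma tdlcsc_quotient (G : topologicalGroupType) (N : normal_subgroup G) :
  tdlcsc G -> closed (N : set G) -> tdlcsc (quotient_group N).
Proof.
move=> tG clN.
apply: (tdlcsc_image (hom_cmap N) (@open_map_cmap _ N) (@cmap_surj _ N) tG).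
rewrite -openC; have -> : ~` [set 1] = @cmap _ N @` (~` N).
  apply/seteqP; split=> [y /= y1|_ [x nNx <-] /cmap1P //].
  by have [x xy] := cmap_surj y; exists x => // Nx; apply: y1; rewrite -xy; exact/cmap1P.
by apply: open_map_cmap; exact: closed_openC.
Qed.

(** * Elementary groups *)

(** Images of compact open sets are open and stable under finite unions. Translates of a compact
    open subgroup show that they cover [D], so one of them contains [D]. *)
Lemma open_map_compact_lift (G : topologicalGroupType) (T : topologicalType)
    (f : G -> T) (D : set T) :
  tdlcsc G -> open_map f -> compact D -> D `<=` range f ->
  exists2 C, compact C & D `<=` f @` C.
Proof.
move=> tG of_ cD Df.
pose F := [set ~` (f @` C) | C in [set C | open C /\ compact C]].
have [||||_ [C [oC cC] <-] DC] := @compact_directed_disjoint _ D F cD.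
- by exists (~` (f @` set0)); exists set0 => //; split; [exact: open0|exact: compact0].
- move=> _ _ [A [oA cA] <-] [B [oB cB] <-]; exists (A `|` B).
    by split; [exact: openU|exact: compactU].
  by rewrite image_setU setCU.
- by move=> _ [C [oC _] <-]; apply: open_closedC; exact: of_.
- apply/seteqP; split=> // d [Dd dF]; have [x _ xd] := Df _ Dd.
  have [U [oU cU _]] := van_dantzig tG (@filterT _ _ (nbhs_filter (1 : G))).
  have oxU : open [set y | U (x^-1 * y)] by exact: open_lmulg.
  have UE : [set y | U (x^-1 * y)] = (fun y => x * y) @` U.
    apply/seteqP; split=> [y Uy|_ [y Uy <-]] /=; last by rewrite mulKg.
    by exists (x^-1 * y) => //; rewrite mulVKg.
  apply: (dF (~` (f @` [set y | U (x^-1 * y)]))).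
    exists [set y | U (x^-1 * y)] => //; split => //.
    by rewrite UE; apply: compact_image => //; exact: lmulg_continuous.
  by exists x => //=; rewrite mulVg; exact: subg1.
exists C => // d Dd; apply: contrapT => nd.
by have : (D `&` ~` (f @` C)) d by []; rewrite DC.
Qed.

Lemma open1_discrete (G : topologicalGroupType) :
  open [set 1 : G] -> discrete_group G.
Proof.
move=> o1 A; have -> : A = \bigcup_(x in A) [set y | [set 1 : G] (x^-1 * y)].
  apply/seteqP; split=> [x Ax|y [x Ax /= xy]].
    by exists x => //=; rewrite mulVg.
  by rewrite -[y](mulVKg x) xy mulg1.
by apply: bigcup_open => x _; exact: open_lmulg.
Qed.

Lemma compact_profinite (G : topologicalGroupType) :
  tdlcsc G -> compact [set: G] -> profinite G.
Proof. by case. Qed.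

Lemma discrete_countable (G : topologicalGroupType) :
  @second_countable G -> discrete_group G -> countable [set: G].
Proof.
move=> /second_countable_seq[b [_ bbase]] dG.
have ex (x : G) : exists n, b n x /\ b n `<=` [set x].
  by apply: bbase; apply: open_nbhs_nbhs; split.
have [f fP] := choice ex.
apply/countable_injP; exists f => x y _ _ fxy.
by have [+ _] := fP x; rewrite fxy => /(fP y).2.
Qed.

(** That is, [G = C N] with [C] compact: compactness of the quotient, stated inside [G]. *)
Definition cocompact (G : topologicalGroupType) (N : set G) :=
  exists2 C : set G, compact C & forall x, exists2 c, C c & N (c^-1 * x).

Lemma profinite_quotient (G : topologicalGroupType) (N : normal_subgroup G) :
  tdlcsc G -> closed (N : set G) ->
  profinite (quotient_group N) <-> cocompact N.
Proof.
move=> tG clN; split=> [[cQ _ _]|[C cC CN]]; last first.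
  apply: compact_profinite; first exact: tdlcsc_quotient.
  have -> : [set: quotient_group N] = @cmap _ N @` C.
    apply/seteqP; split=> // y _; have [x <-] := cmap_surj y.
    by have [c Cc Nc] := CN x; exists c => //; exact/cmap_eqP.
  by apply: compact_image => //; exact: hom_continuous (hom_cmap N).
have [y _|C cC QC] := open_map_compact_lift tG (@open_map_cmap _ N) cQ.
  by have [x xy] := cmap_surj y; exists x.
exists C => // x; have [c Cc /cmap_eqP Nc] := QC (cmap N x) I.
by exists c.
Qed.

Lemma discrete_quotient (G : topologicalGroupType) (N : normal_subgroup G) :
  discrete_group (quotient_group N) <-> open (N : set G).
Proof.
have NE : @cmap _ N @^-1` [set 1] = N by apply/seteqP; split=> x /cmap1P.
split=> [dQ|oN].
  rewrite -NE; apply: open_comp; last exact: dQ.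
  by move=> x _; exact: hom_continuous (hom_cmap N) _.
apply: open1_discrete; have -> : [set 1] = @cmap _ N @` N.
  apply/seteqP; split=> [y ->|_ [x /cmap1P -> <-//]].
  by exists 1; [exact: subg1|exact/cmap1P/subg1].
exact: open_map_cmap.
Qed.

Lemma elementary_compact (G : topologicalGroupType) :
  tdlcsc G -> compact [set: G] -> elementary G.
Proof.
move=> tG cG; apply: elementary_profinite; first by case: tG.
exact: compact_profinite.
Qed.

Lemma elementary_ext (G : topologicalGroupType) (N : normal_subgroup G) :
  tdlcsc G -> closed (N : set G) -> elementary (subgroup_type N) ->
  open (N : set G) \/ cocompact N -> elementary G.
Proof.
move=> tG clN eN oc; apply: (@elementary_extension G N) => //.
by case: oc => [/discrete_quotient|/(profinite_quotient tG clN)]; [right|left].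
Qed.

Lemma discrete_tdlcsc (G : topologicalGroupType) :
  countable [set: G] -> discrete_group G -> tdlcsc G.
Proof.
move=> cG dG; apply: compact_open_base_tdlcsc.
- apply: closed1_hausdorff; rewrite -openC; exact: dG.
- exists (range (@set1 G)); first exact: card_le_trans (card_image_le _ _) cG.
  split=> [A _|x A /nbhs_singleton Ax]; first exact: dG.
  exists [set x]; first by split => //; exists x.
  by move=> y ->.
- move=> W /nbhs_singleton W1; exists (trivg G); split; first exact: dG.
    exact: compact_set1.
  by move=> x ->.
Qed.

Lemma elementary_tdlcsc (G : topologicalGroupType) : elementary G -> tdlcsc G.
Proof.
case=> {}G // => [scG [cG hG tdG]|]; last exact: discrete_tdlcsc.
split => // x _; exists setT; first exact: filterT.
by split => //; exact: closedT.
Qed.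

(** The induction principle used below. The conditions on the quotient by [N] become openness or
    cocompactness of [N], which concern subsets of [G] only. *)
Lemma elementary_cocompact_ind (P : topologicalGroupType -> Prop) :
  (forall G, tdlcsc G -> compact [set: G] -> P G) ->
  (forall G, tdlcsc G -> discrete_group G -> P G) ->
  (forall G (N : normal_subgroup G), tdlcsc G -> closed (N : set G) ->
    elementary (subgroup_type N) -> P (subgroup_type N) ->
    open (N : set G) \/ cocompact N -> P G) ->
  (forall G (O : nat -> subgroup G), tdlcsc G ->
    (forall i, open (O i : set G)) -> (forall i j, (i <= j)%N -> O i `<=` O j) ->
    [set: G] = \bigcup_i O i ->
    (forall i, elementary (subgroup_type (O i))) ->
    (forall i, P (subgroup_type (O i))) -> P G) ->
  forall G, elementary G -> P G.
Proof.
move=> Pc Pd Pe Pu G; elim=> {}G.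
- move=> scG pG; apply: Pc; last by case: pG.
  by apply: elementary_tdlcsc; exact: elementary_profinite.
- by move=> cG dG; apply: Pd => //; exact: discrete_tdlcsc.
- move=> N tG clN eN PN Q; apply: (Pe G N) => //.
  by case: Q => [/(profinite_quotient tG clN)|/discrete_quotient]; [right|left].
- by move=> O tG oO Oincr OG eO PO; exact: (Pu G O).
Qed.

(** * Invariance under topological isomorphism *)

Definition topological_iso (G M : topologicalGroupType) :=
  exists (f : G -> M) (g : M -> G), [/\ hom f, hom g, cancel f g & cancel g f].

Lemma iso_open_map (S T : topologicalType) (f : S -> T) (g : T -> S) :
  continuous g -> cancel f g -> cancel g f -> open_map f.
Proof.
move=> cg fK gK A oA; have -> : f @` A = g @^-1` A.
  apply/seteqP; split=> [_ [x Ax <-]|y Ay] /=; first by rewrite fK.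
  by exists (g y).
by apply: open_comp => // y _; exact: cg.
Qed.

Lemma iso_subgroup (G M : topologicalGroupType) (f : G -> M) (g : M -> G)
    (hf : hom f) (hg : hom g) (N : subgroup G) :
  cancel f g -> cancel g f ->
  topological_iso (subgroup_type N) (subgroup_type (preimg hg N)).
Proof.
move=> fK gK.
have fN (x : subgroup_type N) : preimg hg N (f (emb x)).
  by rewrite /= fK; exact: emb_in.
have gN (x : subgroup_type (preimg hg N)) : N (g (emb x)) by exact: (emb_in x).
exists (lift fN), (lift gN); split.
- by apply: hom_lift; apply: hom_comp => //; exact: hom_emb.
- by apply: hom_lift; apply: hom_comp => //; exact: hom_emb.
- by move=> x; apply: emb_inj; rewrite !emb_lift fK.
- by move=> x; apply: emb_inj; rewrite !emb_lift gK.
Qed.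

Lemma iso_tdlcsc (G M : topologicalGroupType) :
  topological_iso G M -> tdlcsc G -> tdlcsc M.
Proof.
move=> [f [g [hf hg fK gK]]] tG.
apply: (tdlcsc_image hf _ _ tG).
- exact: iso_open_map (hom_continuous hg) fK gK.
- by move=> y; exists (g y).
- apply: hausdorff_closed1.
  apply: (injective_hausdorff (hom_continuous hg) (can_inj gK)).
  by case: tG.
Qed.

(** A subgroup of [subgroup_type H] is only isomorphic to the corresponding subgroup of [G], so
    transport is needed throughout. Each constructor is transported by taking preimages under the
    inverse isomorphism. *)
Theorem elementary_iso (G M : topologicalGroupType) :
  elementary G -> topological_iso G M -> elementary M.
Proof.
move=> eG; move: M.
apply: (@elementary_cocompact_ind
  (fun G => forall M, topological_iso G M -> elementary M)) eG => {}G.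
- move=> tG cG M GM; apply: elementary_compact; first exact: iso_tdlcsc GM tG.
  have [f [g [hf hg fK gK]]] := GM.
  have -> : [set: M] = range f by apply/seteqP; split=> // y _; exists (g y).
  by apply: compact_image => //; exact: hom_continuous.
- move=> tG dG M GM; have tM := iso_tdlcsc GM tG.
  have dM : discrete_group M.
    have [f [g [hf hg fK gK]]] := GM; move=> A.
    have -> : A = f @` (f @^-1` A).
      by apply/seteqP; split=> [y Ay|_ [x Ax <-//]]; exists (g y); rewrite /= gK.
    exact: (iso_open_map (hom_continuous hg) fK gK).
  by apply: elementary_discrete => //; apply: discrete_countable; case: tM.
- move=> N tG clN eN IH Noc M GM; have tM := iso_tdlcsc GM tG.
  have [f [g [hf hg fK gK]]] := GM.
  apply: (@elementary_ext M (npreimg hg N)) => //.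
  + exact: preimg_closed.
  + by apply: IH; exact: iso_subgroup fK gK.
  + case: Noc => [oN|[C cC CN]]; [left|right]; first exact: preimg_open.
    exists (f @` C); first by apply: compact_image => //; exact: hom_continuous.
    move=> y; have [c Cc Nc] := CN (g y); exists (f c); first by exists c.
    by rewrite /= (homM hg) (homV hg) fK.
- move=> O tG oO Oincr GO eO IH M GM; have tM := iso_tdlcsc GM tG.
  have [f [g [hf hg fK gK]]] := GM.
  apply: (@elementary_union M (fun i => preimg hg (O i))) => //.
  + by move=> i; exact: preimg_open.
  + by move=> i j ij y; exact: Oincr.
  + apply/seteqP; split=> // y _; have : [set: G] (g y) by [].
    by rewrite GO => -[i _ Oi]; exists i.
  + by move=> i; apply: IH; exact: iso_subgroup fK gK.
Qed.

(** * Unions and extensions of subgroups of a fixed ambient group *)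

Lemma iso_nested (G : topologicalGroupType) (H N : subgroup G) : N `<=` H ->
  topological_iso (subgroup_type N) (subgroup_type (preimg (hom_emb H) N)).
Proof.
move=> NH.
have f1 (x : subgroup_type N) : H (emb x) by apply: NH; exact: emb_in.
have f2 (x : subgroup_type N) : preimg (hom_emb H) N (lift f1 x).
  by rewrite /= emb_lift; exact: emb_in.
have g1 (x : subgroup_type (preimg (hom_emb H) N)) : N (emb (emb x)).
  exact: (emb_in x).
exists (lift f2), (lift g1); split.
- by apply: hom_lift; apply: hom_lift; exact: hom_emb.
- by apply: hom_lift; apply: hom_comp; exact: hom_emb.
- by move=> x; apply: emb_inj.
- by move=> x; do 2 apply: emb_inj.
Qed.

Lemma elementary_subgroup_union (G : topologicalGroupType) (H : subgroup G)
    (O : nat -> subgroup G) :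
  tdlcsc G -> (forall i, open (O i : set G)) ->
  (forall i j, (i <= j)%N -> O i `<=` O j) -> (H : set G) = \bigcup_i O i ->
  (forall i, elementary (subgroup_type (O i))) -> elementary (subgroup_type H).
Proof.
move=> tG oO Oincr HO eO.
have oH : open (H : set G) by rewrite HO; exact: bigcup_open.
apply: (@elementary_union _ (fun i => preimg (hom_emb H) (O i))).
- by apply: tdlcsc_subgroup => //; exact: open_subgroup_closed.
- by move=> i; exact: preimg_open.
- by move=> i j ij x; exact: Oincr.
- apply/seteqP; split=> // x _; have := emb_in x; rewrite HO => -[i _ Oi].
  by exists i.
- move=> i; apply: elementary_iso (eO i) _; apply: iso_nested.
  by rewrite HO => x; exists i.
Qed.

Lemma nested_normal (G : topologicalGroupType) (H N : subgroup G) :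
  (forall x h, H h -> N x -> N (x ^ h)) ->
  forall x g : subgroup_type H,
  preimg (hom_emb H) N x -> preimg (hom_emb H) N (x ^ g).
Proof.
by move=> HN x g; rewrite /= (homJ (hom_emb H)) => Nx; apply: HN => //; exact: emb_in.
Qed.

(** The extension step for [N] inside [H], with relative openness and cocompactness expressed in
    [G]; this spares later proofs the nested subgroup types. *)
Lemma elementary_subgroup_ext (G : topologicalGroupType) (H N : subgroup G) :
  tdlcsc G -> closed (H : set G) -> closed (N : set G) -> N `<=` H ->
  (forall x h, H h -> N x -> N (x ^ h)) ->
  elementary (subgroup_type N) ->
  (exists O : set G, [/\ open O, O 1 & H `&` O `<=` N]) \/
  (exists2 C : set G, compact C & forall x, H x -> exists2 c, (C `&` H) c & N (c^-1 * x)) ->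
  elementary (subgroup_type H).
Proof.
move=> tG clH clN NH HN eN oc.
pose N' := NormalSubgroup (nested_normal HN).
apply: (@elementary_ext _ N').
- exact: tdlcsc_subgroup.
- exact: preimg_closed.
- by apply: elementary_iso eN _; exact: iso_nested.
- case: oc => [[O' [oO' O1 ON]]|[C' cC CN]]; [left|right].
  + apply: nbhs_subgroup_open.
    have : nbhs (1 : subgroup_type H) (@emb _ H @^-1` O').
      apply: nbhs_preimage; first exact: hom_continuous (hom_emb H).
      by rewrite (hom1 (hom_emb H)); exact: open_nbhs_nbhs.
    by apply: filterS => x Ox; apply: ON; split => //; exact: emb_in.
  + exists (@emb _ H @^-1` C'); first exact: compact_emb_preimage.
    move=> x; have [c [Cc Hc] Nc] := CN (emb x) (emb_in x).
    have [c' c'c] := emb_surj Hc; exists c'; first by rewrite /= c'c.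
    by rewrite /= (homM (hom_emb H)) (homV (hom_emb H)) c'c.
Qed.

Section Restriction.
Variables (G M : topologicalGroupType) (f : G -> M) (hf : hom f) (K : subgroup M).

Lemma resg_subproof (x : subgroup_type (preimg hf K)) : K (f (emb x)).
Proof. exact: (emb_in x). Qed.
Definition resg : subgroup_type (preimg hf K) -> subgroup_type K :=
  lift resg_subproof.

Lemma hom_resg : hom resg.
Proof. by apply: hom_lift; apply: hom_comp => //; exact: hom_emb. Qed.

Lemma resg_inj : injective f -> injective resg.
Proof. by move=> fi x y /(congr1 (@emb _ _)) /fi /emb_inj. Qed.

Lemma resg_surj :
  (forall y, exists x, f x = y) -> forall y, exists x, resg x = y.
Proof.
move=> fs y; have [x xy] := fs (emb y).
have [|x' x'x] := @emb_surj _ (preimg hf K) x.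
  by rewrite /= xy; exact: emb_in.
by exists x'; apply: emb_inj; rewrite emb_lift x'x.
Qed.

Lemma resg_open_map : open_map f -> open_map resg.
Proof.
move=> of_ A /emb_open[O oO ->]; apply/emb_open.
exists (f @` O); first exact: of_.
apply/seteqP; split=> [_ [x Ox <-]|y [x Ox xy]]; first by exists (emb x).
have [|x' x'x] := @emb_surj _ (preimg hf K) x.
  by rewrite /= xy; exact: emb_in.
exists x'; first by rewrite /= x'x.
by apply: emb_inj; rewrite emb_lift x'x.
Qed.

End Restriction.

(** The kernel of [f] already lies in the preimage of [K], so restricting [f] changes the kernel
    only up to isomorphism. *)
Lemma elementary_ker_resg (G M : topologicalGroupType) (f : G -> M)
    (hf : hom f) (K : subgroup M) :
  elementary (subgroup_type (npreimg hf (trivg M))) ->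
  elementary (subgroup_type (npreimg (hom_resg hf K) (trivg _))).
Proof.
move=> ek; have kK : (npreimg hf (trivg M)) `<=` preimg hf K.
  by move=> x /= ->; exact: subg1.
apply: (elementary_iso ek).
suff -> : normal_subgroup_sub (npreimg (hom_resg hf K) (trivg _)) =
    preimg (hom_emb (preimg hf K)) (npreimg hf (trivg M)) by exact: iso_nested.
apply: subgroup_eq; apply/seteqP; split=> x /=.
  by move=> /(congr1 (@emb _ _)); rewrite (hom1 (hom_emb K)).
by move=> fx; apply: emb_inj; rewrite (hom1 (hom_emb K)).
Qed.

(** Induction on [Q], pulling its construction back along [f]; the kernel takes the place of the
    trivial group in the base cases. Openness of [f] allows compact sets, and hence cocompactness,
    to be lifted to [G]. *)
Theorem elementary_open_extension (Q : topologicalGroupType) : elementary Q ->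
  forall (G : topologicalGroupType) (f : G -> Q) (hf : hom f), tdlcsc G ->
  open_map f -> (forall y, exists x, f x = y) ->
  elementary (subgroup_type (npreimg hf (trivg Q))) -> elementary G.
Proof.
move: Q; apply: elementary_cocompact_ind => Q.
- move=> tQ cQ G f hf tG of_ fs ek.
  apply: (elementary_ext tG _ ek).
    by apply: preimg_closed; exact: tdlcsc_closed1.
  have [|C cC QC] := open_map_compact_lift tG of_ cQ.
    by move=> y _; have [x xy] := fs y; exists x.
  right; exists C => // x; have [c Cc cx] := QC (f x) I.
  by exists c => //=; rewrite (homM hf) (homV hf) cx mulVg.
- move=> tQ dQ G f hf tG of_ fs ek.
  apply: (elementary_ext tG _ ek); last by left; apply: preimg_open; exact: dQ.
  by apply: preimg_closed; exact: tdlcsc_closed1.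
- move=> N tQ clN eN IH Noc G f hf tG of_ fs ek.
  have clN' : closed (npreimg hf N : set G) by exact: preimg_closed.
  apply: (@elementary_ext _ (npreimg hf N)) => //.
  + apply: (IH _ _ (hom_resg hf N)).
    * exact: tdlcsc_subgroup.
    * exact: resg_open_map.
    * exact: resg_surj.
    * exact: elementary_ker_resg.
  + case: Noc => [oN|[C cC CN]]; first by left; exact: preimg_open.
    have [|C' cC' CC'] := open_map_compact_lift tG of_ cC.
      by move=> y _; have [x xy] := fs y; exists x.
    right; exists C' => // x; have [c /CC'[c' C'c' <-] Nc] := CN (f x).
    by exists c' => //=; rewrite (homM hf) (homV hf).
- move=> O tQ oO Oincr QO eO IH G f hf tG of_ fs ek.
  apply: (@elementary_union _ (fun i => preimg hf (O i))) => //.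
  + by move=> i; exact: preimg_open.
  + by move=> i j ij x; exact: Oincr.
  + apply/seteqP; split=> // x _; have : [set: Q] (f x) by [].
    by rewrite QO => -[i _ Oi]; exists i.
  + move=> i; apply: (IH i _ _ (hom_resg hf (O i))).
    * apply: tdlcsc_subgroup => //; apply: preimg_closed.
      exact: open_subgroup_closed.
    * exact: resg_open_map.
    * exact: resg_surj.
    * exact: elementary_ker_resg.
Qed.

Section QuotientLift.
Variables (G M : topologicalGroupType) (N : normal_subgroup G) (f : G -> M).
Hypotheses (hf : hom f) (Nf : forall x, N x -> f x = 1).

Definition qlift (y : quotient_group N) : M := f (repr y).

Lemma qlift_cmap x : qlift (cmap N x) = f x.
Proof.
have /cmap_eqP /Nf : cmap N (repr (cmap N x)) = cmap N x by rewrite /cmap reprK.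
rewrite (homM hf) (homV hf) => e.
by rewrite -[RHS](mulVKg (qlift (cmap N x))) e mulg1.
Qed.

Lemma hom_qlift : hom qlift.
Proof.
split; last first.
  move=> a b; have [x <-] := cmap_surj a; have [y <-] := cmap_surj b.
  by rewrite -(homM (hom_cmap N)) !qlift_cmap (homM hf).
apply/(@quotient_continuous G {eq_quot (coset_equiv N)}).
rewrite (_ : _ \o _ = f); first exact: hom_continuous.
by apply/funext => x; exact: qlift_cmap.
Qed.

Lemma qlift_open_map : open_map f -> open_map qlift.
Proof.
move=> of_ A oA; have -> : qlift @` A = f @` (@cmap _ N @^-1` A).
  apply/seteqP; split=> [_ [y Ay <-]|_ [x Ax <-]].
    have [x xy] := cmap_surj y; exists x; first by rewrite /= xy.
    by rewrite -qlift_cmap xy.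
  by exists (cmap N x) => //; exact: qlift_cmap.
apply: of_; apply: open_comp => // x _; exact: (hom_continuous (hom_cmap N)).
Qed.

Lemma qlift_inj : (forall x, f x = 1 -> N x) -> injective qlift.
Proof.
move=> fN; apply: (ker1_inj hom_qlift) => y; have [x <-] := cmap_surj y.
by rewrite qlift_cmap => /fN /cmap1P.
Qed.

End QuotientLift.

(** * Residually discrete groups *)

Section Normalizer.
Variable G : topologicalGroupType.

Lemma normg_subproof (A : set G) :
  is_subgroup [set x : G | forall a, A a -> A (a ^ x) /\ A (a ^ x^-1)].
Proof.
split=> [a Aa|x y Nx Ny a Aa|x Nx a Aa] /=.
- by rewrite invg1 conjg1.
- rewrite invgM !conjgM; split; first by apply: (Ny _ _).1; exact: (Nx _ _).1.
  by apply: (Nx _ _).2; exact: (Ny _ _).2.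
- by rewrite invgK; have [] := Nx a Aa.
Qed.
(** The normaliser of [A]. Both [x] and [x^-1] must conjugate [A] into itself, as one inclusion
    alone need not be inherited by inverses. *)
Definition normg A := Subgroup (normg_subproof A).

Lemma normgP (H : subgroup G) (A : set G) :
  (forall a x, H x -> A a -> A (a ^ x)) -> H `<=` normg A.
Proof.
by move=> HA x Hx a Aa; split; apply: HA => //; exact: subgV.
Qed.

Lemma mulsub_subproof (H K : subgroup G) :
  (forall k h, H h -> K k -> K (k ^ h)) ->
  is_subgroup [set x | exists2 h, H h & K (h^-1 * x)].
Proof.
move=> HK; split=> [|x y [h Hh Kx] [h' Hh' Ky]|x [h Hh Kx]].
- by exists 1; [exact: subg1|rewrite invg1 mulg1; exact: subg1].
- exists (h * h'); first exact: subgM.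
  have -> : (h * h')^-1 * (x * y) = (h^-1 * x) ^ h' * (h'^-1 * y).
    by rewrite conjgE invgM !mulgA mulgK.
  by apply: subgM => //; exact: HK.
- exists h^-1; first exact: subgV.
  have -> : h^-1^-1 * x^-1 = ((h^-1 * x)^-1) ^ h^-1.
    by rewrite conjgE invgM !invgK !mulgA mulgK.
  by apply: HK; [exact: subgV|exact: subgV].
Qed.
(** The product [H K], a subgroup because [H] normalises [K]. *)
Definition mulsub H K HK := Subgroup (@mulsub_subproof H K HK).

End Normalizer.

(* The compact set U ^ t `\` U misses N_n for n large, and then
   (N_n `&` U) ^ t is contained in U. *)
Lemma normalizer_exhaustion (G : topologicalGroupType) (U : subgroup G)
    (N : nat -> subgroup G) :
  hausdorff_space G -> open (U : set G) -> compact U ->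
  (forall n x g, N n x -> N n (x ^ g)) ->
  (forall n, closed (N n : set G)) ->
  (forall i j, (i <= j)%N -> N j `<=` N i) ->
  (forall x, (forall n, N n x) -> x = 1) ->
  [/\ forall n, open (normg (N n `&` U) : set G),
      forall i j, (i <= j)%N -> normg (N i `&` U) `<=` normg (N j `&` U) &
      forall t, exists n, normg (N n `&` U) t].
Proof.
move=> hG oU cU Nn clN Ndecr N1; split.
- move=> n; apply: nbhs_subgroup_open; apply: filterS (open_nbhs1 oU).
  by apply: normgP => a x Ux [Na Ua]; split; [exact: Nn|exact: subgJ].
- move=> i j ij t Nt a [Na Ua]; have [|[_ U1] [_ U2]] := Nt a.
    by split => //; exact: Ndecr Na.
  by split; split => //; exact: Nn.
- move=> t.
  have small s : exists n, forall a, N n a -> U a -> U (a ^ s).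
    have cC : compact ((fun x => x ^ s) @` U `&` ~` U).
      apply: compact_closedI; last exact: open_closedC.
      by apply: compact_image => //; exact: conjgl_continuous.
    have [|n Nn'] := compact_decreasing_disjoint cC Ndecr clN.
      move=> x [_ nUx] /N1 x1; apply: nUx; rewrite x1; exact: subg1.
    exists n => a Na Ua; apply: contrapT => nU.
    by apply: (Nn' (a ^ s)); [split => //; exists a|exact: Nn].
  have [n1 Hn1] := small t; have [n2 Hn2] := small t^-1.
  exists (maxn n1 n2) => a [Na Ua]; split; split; try exact: Nn.
  + by apply: Hn1 => //; apply: Ndecr Na; exact: leq_maxl.
  + by apply: Hn2 => //; apply: Ndecr Na; exact: leq_maxr.
Qed.

Lemma elementary_compact_subgroup (G : topologicalGroupType) (H : subgroup G) :
  tdlcsc G -> closed (H : set G) -> compact H -> elementary (subgroup_type H).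
Proof.
move=> tG clH cH; apply: elementary_compact; first exact: tdlcsc_subgroup.
have -> : [set: subgroup_type H] = @emb _ H @^-1` H.
  by apply/seteqP; split=> // x _; exact: emb_in.
exact: compact_emb_preimage.
Qed.

Lemma elementary_trivg (G : topologicalGroupType) :
  tdlcsc G -> elementary (subgroup_type (trivg G)).
Proof.
move=> tG; apply: elementary_compact_subgroup => //; first exact: tdlcsc_closed1.
exact: compact_set1.
Qed.

Lemma elementary_compact_by_discrete (G : topologicalGroupType)
    (H N : subgroup G) (O : set G) :
  tdlcsc G -> closed (H : set G) -> closed (N : set G) -> compact N ->
  N `<=` H -> (forall x h, H h -> N x -> N (x ^ h)) ->
  open O -> O 1 -> H `&` O `<=` N -> elementary (subgroup_type H).
Proof.
move=> tG clH clN cN NH HN oO O1 HO.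
apply: (@elementary_subgroup_ext _ H N) => //; last by left; exists O.
exact: elementary_compact_subgroup.
Qed.

(** * Groups [O = P U] with [U] compact open and [P] discrete modulo [Z] *)

Section CompactByDiscreteByCompact.
Variables (G M : topologicalGroupType) (g : G -> M) (hg : hom g).
Variables (O P U Z : subgroup G).
Hypotheses (tG : tdlcsc G) (tM : tdlcsc M) (og : open_map g).
Hypotheses (oU : open (U : set G)) (cU : compact U) (UO : U `<=` O).
Hypotheses (PO : forall x y, O y -> P x -> P (x ^ y)).
Hypothesis OPU : forall x, O x -> exists2 k, P k & U (k^-1 * x).
Hypotheses (POs : P `<=` O) (ZU : Z `<=` U).
Hypothesis ZO : forall x y, O y -> Z x -> Z (x ^ y).
Hypothesis PZ : exists2 Y, nbhs (1 : G) Y & P `&` Y `<=` Z.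

(* Modulo Z every element of P is centralised by a small subgroup V_m of U, so
   V_m Z is a compact open subgroup normalised by it. *)
Lemma elementary_image_compact_by_discrete_by_compact :
  elementary (subgroup_type (imageg hg O)).
Proof.
have [V [oV Vdecr VU Vbase]] := invariant_base tG cU (subg1 U) (@subgM _ U).
have VZ m k h : subgI (V m) U h -> Z k -> Z (k ^ h).
  by move=> [_ /UO Oh]; exact: ZO.
pose X m := mulsub (VZ m).
have VX m x : V m x -> U x -> X m x.
  by move=> Vx Ux; exists x => //; rewrite mulVg; exact: subg1.
have oX m : open (X m : set G).
  apply: nbhs_subgroup_open.
  apply: filterS (filterI (open_nbhs1 (oV m)) (open_nbhs1 oU)).
  by move=> x [Vx Ux]; exact: VX.
have XU m : X m `<=` U.
  by move=> x [v [_ Uv] /ZU]; apply: subgMl; exact: subgV.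
have cX m : compact (X m).
  by apply: (subclosed_compact _ cU) => //; exact: open_subgroup_closed.
(* Normalising every [X j] from [m] on, and not just [X m], makes the subgroups [R m] increase with
   [m]. *)
pose N m := fun x => forall j, (m <= j)%N -> normg (X j) x.
have Nsub m : is_subgroup (O `&` N m).
  split=> [|x y [Ox Nx] [Oy Ny]|x [Ox Nx]].
  - by split; [exact: subg1|move=> j _; exact: subg1].
  - by split; [exact: subgM|move=> j mj; apply: subgM; [exact: Nx|exact: Ny]].
  - by split; [exact: subgV|move=> j mj; apply: subgV; exact: Nx].
pose R m := Subgroup (Nsub m).
have UR m : U `<=` R m.
  move=> u Uu; split=> [|j _]; first exact: UO.
  move: u Uu; apply: normgP => a x Ux [v [Vv Uv] Zv].
  exists (v ^ x); first by split; [exact: VU|exact: subgJ].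
  by rewrite -conjVg -conjMg; apply: ZO => //; exact: UO.
have oR m : open (R m : set G).
  by apply: nbhs_subgroup_open; apply: filterS (open_nbhs1 oU); exact: UR.
apply: (@elementary_subgroup_union _ _ (fun m => imageg hg (R m))) => //.
- by move=> m; exact: og.
- move=> i j ij _ [x [Ox Nx] <-]; exists x => //; split => // l jl.
  by apply: Nx; exact: leq_trans jl.
- apply/seteqP; split=> [_ [x Ox <-]|_ [m _ [x [Ox _] <-]]]; last by exists x.
  suff [m Rx] : exists m, R m x by exists m => //; exists x.
  have [k Pk Uk] := OPU Ox.
  have [Y nY YZ] := PZ.
  (* The commutator of [v] and [s] lies in [P] because [O] normalises [P], and it is close to 1 when
     [v] is; so it lies in [Z]. *)
  have small s : P s -> exists m, forall j v, (m <= j)%N ->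
      V j v -> U v -> Z (v^-1 * v ^ s).
    move=> Ps.
    have : nbhs (1 : G) ((fun v => v^-1 * v ^ s) @^-1` Y).
      apply: nbhs_preimage; last by rewrite conj1g invg1 mulg1.
      move=> v; apply: cvgMg; first exact: inv_continuous.
      exact: conjgl_continuous.
    move=> /Vbase[m VY]; exists m => j v mj /(Vdecr _ _ mj) /VY /= Yv Uv.
    apply: YZ; split => //.
    have -> : v^-1 * v ^ s = (s ^ v)^-1 * s.
      by rewrite !conjgE !invgM !invgK !mulgA.
    by apply: subgM => //; apply: subgV; apply: PO => //; exact: UO.
  have smallX s m : P s -> (forall j v, (m <= j)%N ->
      V j v -> U v -> Z (v^-1 * v ^ s)) ->
      forall j, (m <= j)%N -> forall a, X j a -> X j (a ^ s).
    move=> Ps Hs j mj a [v [Vv Uv] Zv]; exists v => //.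
    have -> : v^-1 * a ^ s = (v^-1 * v ^ s) * (v^-1 * a) ^ s.
      by rewrite conjMg conjVg -[RHS]mulgA mulVKg.
    by apply: subgM; [exact: Hs mj _ _|apply: ZO => //; exact: POs].
  have [m1 H1] := small k Pk; have [m2 H2] := small k^-1 (subgV Pk).
  exists (maxn m1 m2); rewrite -[x](mulVKg k); apply: subgM; last exact: UR.
  split=> [|j mj a Xa]; first exact: POs.
  split; [apply: smallX H1 _ _ _ _ => //|apply: smallX H2 _ _ _ _ => //].
  + exact: leq_trans (leq_maxl _ _) mj.
  + exact: subgV.
  + exact: leq_trans (leq_maxr _ _) mj.
(* The image of [X m] is a compact open normal subgroup of the image of [R m]. *)
- move=> m; apply: (@elementary_compact_by_discrete _ (imageg hg (R m))
    (imageg hg (X m)) (imageg hg (X m))) => //.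
  + by apply: open_subgroup_closed; exact: og.
  + by apply: open_subgroup_closed; exact: og.
  + by apply: compact_image => //; exact: hom_continuous.
  + move=> _ [x Xx <-]; exists x => //; apply: UR; exact: XU Xx.
  + move=> _ _ [h [_ Nh] <-] [x Xx <-]; rewrite -(homJ hg).
    by exists (x ^ h) => //; exact: (Nh m (leqnn m) x Xx).1.
  + exact: og.
  + exact: (subg1 (imageg hg (X m))).
Qed.

End CompactByDiscreteByCompact.

(** By [normalizer_exhaustion], [G] is the increasing union of the normalisers [O n] of the
    intersections of [N n] with [U]. The preceding section applies to [O n], with [P] its
    intersection with [K] and [Z] that of [N n] with [U]; relative openness of [N n] in [K] makes
    [P] discrete modulo [Z]. The case of the identity map serves injections, the general one
    quotients. *)
Lemma elementary_image_residually_discrete (G M : topologicalGroupType)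
    (g : G -> M) (U : subgroup G) (K : normal_subgroup G)
    (N : nat -> normal_subgroup G) :
  hom g -> open_map g -> (forall y, exists x, g x = y) ->
  tdlcsc G -> tdlcsc M -> open (U : set G) -> compact U ->
  (forall x, exists2 k, K k & U (k^-1 * x)) ->
  (forall n, closed (N n : set G)) ->
  (forall i j, (i <= j)%N -> N j `<=` N i) ->
  (forall n, N n `<=` K) ->
  (forall x, (forall n, N n x) -> x = 1) ->
  (forall n, exists2 Y, nbhs (1 : G) Y & K `&` Y `<=` N n) ->
  elementary M.
Proof.
move=> hg og gs tG tM oU cU GKU clN Ndecr NK N1 NY.
have hG : hausdorff_space G by case: tG.
have Nn n x t : N n x -> N n (x ^ t) by exact: normal_subgroupP.
have [oO Oincr GO] := normalizer_exhaustion hG oU cU Nn clN Ndecr N1.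
pose O n := normg (N n `&` U).
apply: (@elementary_union M (fun n => imageg hg (O n))) => //.
- by move=> n; apply: og; exact: oO.
- by move=> i j ij _ [x Ox <-]; exists x => //; exact: Oincr Ox.
- apply/seteqP; split=> // y _; have [x <-] := gs y.
  by have [n On] := GO x; exists n => //; exists x.
move=> n.
have UO : U `<=` O n.
  by apply: normgP => a x Ux [Na Ua]; split; [exact: Nn|exact: subgJ].
apply: (@elementary_image_compact_by_discrete_by_compact _ _ _ hg (O n)
  (subgI (O n) K) U (subgI (N n) U)) => //.
- move=> x y Oy [Ox Kx]; split; first exact: subgJ.
  exact: normal_subgroupP.
- move=> x Ox; have [k Kk Uk] := GKU x; exists k => //; split => //.
  have : O n (k^-1 * x) by exact: UO.
  by move=> /(subgMr Ox) /subgVr.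
- by move=> x [].
- by move=> x [].
- by move=> x y Oy Zx; exact: (Oy x Zx).1.
- have [Y nY YN] := NY n; exists (Y `&` U).
    by apply: filterI => //; exact: open_nbhs1.
  by move=> x [[Ox Kx] [Yx Ux]]; split => //; apply: YN.
Qed.

(** * Injections and extensions *)

Lemma discrete_elementary (G : topologicalGroupType) :
  tdlcsc G -> open [set 1 : G] -> elementary G.
Proof.
move=> tG o1; have dG := open1_discrete o1.
by apply: elementary_discrete => //; apply: discrete_countable; case: tG.
Qed.

Lemma open_normal_base (G : topologicalGroupType) :
  tdlcsc G -> compact [set: G] -> exists V : nat -> normal_subgroup G,
  [/\ forall n, open (V n : set G),
      forall i j, (i <= j)%N -> V j `<=` V i &
      forall x, (forall n, V n x) -> x = 1].
Proof.
move=> tG cG; have [hG _ _ _] := tG.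
have [V [oV Vdecr VJ Vbase]] := invariant_base tG cG I (fun _ _ _ _ => I).
exists (fun n => NormalSubgroup (fun x g => VJ n x g I)); split => //= x Vx.
apply: contrapT => x1.
have [|n Vn] := Vbase (~` [set x]); last exact: (Vn x (Vx n)) erefl.
apply: open_nbhs_nbhs; split; last by move=> /= e; apply: x1; rewrite -e.
apply: closed_openC.
exact: accessible_closed_set1 (hausdorff_accessible hG) _.
Qed.

(** Both kinds of quotient allowed in an extension are residually discrete: if [N] is open a
    constant sequence works, otherwise an open normal base of the compact quotient is pulled
    back. *)
Lemma residually_discrete_quotient (G : topologicalGroupType)
    (N : normal_subgroup G) :
  tdlcsc G -> closed (N : set G) -> open (N : set G) \/ cocompact N ->
  exists V : nat -> normal_subgroup G,
  [/\ forall n, open (V n : set G), forall i j, (i <= j)%N -> V j `<=` V i,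
      forall n, N `<=` V n & forall x, (forall n, V n x) -> N x].
Proof.
move=> tG clN [oN|Nco]; first by exists (fun=> N); split=> [_|i j _|_|x /(_ 0%N)].
have [cQ _ _] := (profinite_quotient tG clN).2 Nco.
have [V [oV Vdecr V1]] := open_normal_base (tdlcsc_quotient tG clN) cQ.
exists (fun n => npreimg (hom_cmap N) (V n)); split.
- by move=> n; exact: preimg_open.
- by move=> i j ij x; exact: Vdecr.
- by move=> n x /cmap1P /= ->; exact: subg1.
- by move=> x Vx; apply/cmap1P/V1.
Qed.

(** Open normal subgroups of [Q] with trivial intersection pull back to such subgroups of [G], and
    [elementary_image_residually_discrete] applies with [K] the whole group. *)
Lemma elementary_injective_compact (Q G : topologicalGroupType) (f : G -> Q) :
  tdlcsc Q -> compact [set: Q] -> tdlcsc G -> hom f -> injective f ->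
  elementary G.
Proof.
move=> tQ cQ tG hf fi.
have [V [oV Vdecr V1]] := open_normal_base tQ cQ.
have [U [oU cU _]] := van_dantzig tG (@filterT _ _ (nbhs_filter (1 : G))).
have oK n : open (npreimg hf (V n) : set G) by exact: preimg_open.
apply: (@elementary_image_residually_discrete G G id U (fullg G)
  (fun n => npreimg hf (V n))) => //.
- exact: hom_id.
- by move=> A oA; rewrite image_id.
- by move=> y; exists y.
- by move=> x; exists x => //; rewrite mulVg; exact: subg1.
- by move=> n; exact: open_subgroup_closed.
- by move=> i j ij x; exact: Vdecr.
- by move=> x Vx; apply: fi; rewrite (hom1 hf); exact: V1.
- move=> n; exists (npreimg hf (V n)); first exact: open_nbhs1.
  by move=> x [].
Qed.

Theorem elementary_injective (Q : topologicalGroupType) : elementary Q ->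
  forall (G : topologicalGroupType) (f : G -> Q), tdlcsc G -> hom f ->
  injective f -> elementary G.
Proof.
move: Q; apply: elementary_cocompact_ind => Q.
- by move=> tQ cQ G f tG hf fi; exact: (elementary_injective_compact tQ cQ tG hf).
- move=> tQ dQ G f tG hf fi; apply: discrete_elementary => //.
  have -> : [set 1] = f @^-1` [set 1].
    apply/seteqP; split=> x /= => [->|fx]; first exact: hom1.
    by apply: fi; rewrite fx (hom1 hf).
  by apply: open_comp => [x _|]; [exact: hom_continuous|exact: dQ].
- move=> N tQ clN eN IH Noc G f tG hf fi.
  have clN' : closed (npreimg hf N : set G) by exact: preimg_closed.
  have eN' : elementary (subgroup_type (npreimg hf N)).
    apply: (IH _ _ _ (hom_resg hf N)); first exact: tdlcsc_subgroup.
    exact: resg_inj.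
  case: Noc => [oN|Nco].
    by apply: (elementary_ext tG clN' eN'); left; exact: preimg_open.
  (* Cocompactness of [N] need not pass to its preimage under an injection. Instead, the quotient of
     [G] by that preimage injects into the compact quotient of [Q] by [N], and
     [elementary_open_extension] assembles the two pieces. *)
  have tQN := tdlcsc_quotient tQ clN.
  have [cQN _ _] := (profinite_quotient tQ clN).2 Nco.
  have hfN : hom (cmap N \o f) by apply: hom_comp => //; exact: hom_cmap.
  have kf x : npreimg hf N x -> (cmap N \o f) x = 1 by move=> Nx; apply/cmap1P.
  have eGN : elementary (quotient_group (npreimg hf N)).
    apply: (elementary_injective_compact tQN cQN _ (hom_qlift hfN kf)).
      exact: tdlcsc_quotient.
    by apply: qlift_inj => // x /cmap1P.
  apply: (elementary_open_extension eGN (hf := hom_cmap (npreimg hf N))) => //.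
  + exact: open_map_cmap.
  + exact: cmap_surj.
  + suff -> : npreimg (hom_cmap (npreimg hf N)) (trivg _) = npreimg hf N by [].
    by apply: normal_subgroup_eq; apply/seteqP; split=> x /cmap1P.
- move=> O tQ oO Oincr QO eO IH G f tG hf fi.
  apply: (@elementary_union _ (fun i => preimg hf (O i))) => //.
  + by move=> i; exact: preimg_open.
  + by move=> i j ij x; exact: Oincr.
  + apply/seteqP; split=> // x _; have : [set: Q] (f x) by [].
    by rewrite QO => -[i _ Oi]; exists i.
  + move=> i; apply: (IH i _ _ _ (hom_resg hf (O i))).
    * apply: tdlcsc_subgroup => //; apply: preimg_closed.
      exact: open_subgroup_closed.
    * exact: resg_inj.
Qed.

Lemma elementary_subgroup_sub (G : topologicalGroupType) (H K : subgroup G) :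
  tdlcsc G -> closed (K : set G) -> K `<=` H -> elementary (subgroup_type H) ->
  elementary (subgroup_type K).
Proof.
move=> tG clK KH eH.
have KH' (x : subgroup_type K) : H (emb x) by apply: KH; exact: emb_in.
apply: (elementary_injective eH (f := lift KH')).
- exact: tdlcsc_subgroup.
- by apply: hom_lift; exact: hom_emb.
- by apply: lift_inj; exact: emb_inj.
Qed.

(** The quotient of [G] by the kernel injects into [Q], so it is elementary; the projection onto it
    is open, as [elementary_open_extension] requires. *)
Theorem elementary_hom_extension (Q G : topologicalGroupType) (f : G -> Q)
    (hf : hom f) :
  elementary Q -> tdlcsc G ->
  elementary (subgroup_type (npreimg hf (trivg Q))) -> elementary G.
Proof.
move=> eQ tG ek; set N := npreimg hf (trivg Q) in ek *.
have clN : closed (N : set G).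
  by apply: preimg_closed; apply: tdlcsc_closed1; exact: elementary_tdlcsc.
have eGN : elementary (quotient_group N).
  apply: (elementary_injective eQ (f := @qlift _ _ N f)).
  - exact: tdlcsc_quotient.
  - exact: hom_qlift.
  - exact: qlift_inj.
apply: (elementary_open_extension eGN (hf := hom_cmap N)) => //.
- exact: open_map_cmap.
- exact: cmap_surj.
- suff -> : npreimg (hom_cmap N) (trivg _) = N by [].
  by apply: normal_subgroup_eq; apply/seteqP; split=> x /cmap1P.
Qed.

Corollary elementary_quotient_extension (G : topologicalGroupType)
    (N : normal_subgroup G) :
  tdlcsc G -> elementary (subgroup_type N) -> elementary (quotient_group N) ->
  elementary G.
Proof.
move=> tG eN eGN.
apply: (@elementary_hom_extension _ _ _ (hom_cmap N)) => //.
suff -> : npreimg (hom_cmap N) (trivg _) = N by [].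
by apply: normal_subgroup_eq; apply/seteqP; split=> x /cmap1P.
Qed.

(** * Quotients and closures of images *)

Lemma closureg_subproof (G : topologicalGroupType) (H : subgroup G) :
  is_subgroup (closure H).
Proof.
split; first exact/subset_closure/subg1.
- move=> x y clx cly W /(mul_continuous (x, y)) [[A B] /= [xA yB] AB].
  have [a [Ha Aa]] := clx A xA; have [b [Hb Bb]] := cly B yB.
  by exists (a * b); split; [exact: subgM|exact: (AB (a, b))].
- move=> x clx W /(nbhs_preimage (@inv_continuous G)) /clx [a [Ha Wa]].
  by exists a^-1; split => //; exact: subgV.
Qed.
Definition closureg G H := Subgroup (@closureg_subproof G H).

Section NormalImage.
Variables (G M : topologicalGroupType) (g : G -> M).
Hypotheses (hg : hom g) (gs : forall y, exists x, g x = y).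

Lemma imageg_normal (N : normal_subgroup G) x y :
  imageg hg N x -> imageg hg N (x ^ y).
Proof.
move=> [a Na <-]; have [b <-] := gs y; exists (a ^ b); last exact: homJ.
exact: normal_subgroupP.
Qed.
Definition nimageg N := NormalSubgroup (@imageg_normal N).

Lemma closureg_normal (N : normal_subgroup G) x y :
  closureg (imageg hg N) x -> closureg (imageg hg N) (x ^ y).
Proof.
move=> clx W /(nbhs_preimage (@conjgl_continuous _ y)) /clx [a [Na Wa]].
by exists (a ^ y); split => //; exact: imageg_normal.
Qed.
Definition nclosureg N := NormalSubgroup (@closureg_normal N).

Lemma imageg_sat (H : subgroup G) x :
  (forall x, g x = 1 -> H x) -> imageg hg H (g x) -> H x.
Proof.
move=> kH [y Hy yx]; apply: (subgMl (subgV Hy)); apply: kH.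
by rewrite (homM hg) (homV hg) yx mulVg.
Qed.

Lemma imageg_closed (H : subgroup G) : open_map g ->
  (forall x, g x = 1 -> H x) -> closed (H : set G) ->
  closed (imageg hg H : set M).
Proof.
move=> og kH clH; rewrite -openC.
have -> : ~` (imageg hg H : set M) = g @` (~` H).
  apply/seteqP; split=> [y ny|_ [x nHx <-] /imageg_sat]; last by move=> /(_ kH).
  have [x xy] := gs y; exists x => // Hx; apply: ny; exists x => //.
by apply: og; exact: closed_openC.
Qed.

End NormalImage.

(* Since K is only assumed to inject into Q, this property can be proved by
   induction on elementary Q although the steps of the induction replace K by
   U-cores that are not inverse images of members of the filtration of Q. *)
Definition cocompact_quotients_elementary (Q : topologicalGroupType) : Prop :=
  forall (G M : topologicalGroupType) (g : G -> M) (K : normal_subgroup G)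
    (U : subgroup G) (f : subgroup_type K -> Q),
  hom g -> open_map g -> (forall y, exists x, g x = y) ->
  tdlcsc G -> tdlcsc M -> closed (K : set G) ->
  open (U : set G) -> compact U -> (forall x, exists2 k, K k & U (k^-1 * x)) ->
  hom f -> injective f -> elementary M.

(** The property for [Q] is applied to the open subgroup [O] and its image, so that [K] has to be
    normalised by [O] only. *)
Lemma elementary_image_cocompact (Q G M : topologicalGroupType) (g : G -> M)
    (hg : hom g) (O U K : subgroup G) (f : subgroup_type K -> Q) :
  cocompact_quotients_elementary Q ->
  open_map g -> tdlcsc G -> tdlcsc M -> open (O : set G) -> open (U : set G) ->
  compact U -> U `<=` O -> closed (K : set G) -> K `<=` O ->
  (forall x y, O y -> K x -> K (x ^ y)) ->
  (forall x, O x -> exists2 k, K k & U (k^-1 * x)) ->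
  hom f -> injective f -> elementary (subgroup_type (imageg hg O)).
Proof.
move=> HQ og tG tM oO oU cU UO clK KO KJ OKU hf fi.
have gO (x : subgroup_type O) : imageg hg O (g (emb x)).
  by exists (emb x) => //; exact: emb_in.
have clO := open_subgroup_closed oO.
pose K' := NormalSubgroup (nested_normal KJ).
pose f' : subgroup_type K' -> Q := f \o @resg _ _ _ (hom_emb O) K.
apply: (HQ _ _ (lift gO) K' (preimg (hom_emb O) U) f') => //.
- by apply: hom_lift; apply: hom_comp => //; exact: hom_emb.
- move=> A oA; apply/emb_open; exists (g @` (@emb _ O @` A)).
    by apply: og; exact: open_map_emb.
  apply/seteqP; split=> [_ [x Ax <-]|y [_ [x Ax <-] xy]].
    by exists (emb x) => //; exists x.
  by exists x => //; apply: emb_inj; rewrite emb_lift.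
- move=> y; have [x Ox xy] := emb_in y; have [x' x'x] := emb_surj Ox.
  by exists x'; apply: emb_inj; rewrite emb_lift x'x.
- exact: tdlcsc_subgroup.
- by apply: tdlcsc_subgroup => //; apply: open_subgroup_closed; exact: og.
- exact: preimg_closed.
- exact: preimg_open.
- exact: compact_emb_preimage.
- move=> x; have [k Kk Uk] := OKU _ (emb_in x).
  have [k' k'k] := emb_surj (KO _ Kk); exists k'; first by rewrite /= k'k.
  by rewrite /= (homM (hom_emb O)) (homV (hom_emb O)) k'k.
- by apply: hom_comp => //; exact: hom_resg.
- by apply: inj_comp => //; apply: resg_inj; exact: emb_inj.
Qed.

(* g (K U) is an open, hence closed, subgroup containing g K. *)
Lemma elementary_closure_image (Q G M : topologicalGroupType) (g : G -> M)
    (hg : hom g) (K : normal_subgroup G) (f : subgroup_type K -> Q) :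
  cocompact_quotients_elementary Q -> open_map g -> tdlcsc G -> tdlcsc M ->
  closed (K : set G) -> hom f -> injective f ->
  elementary (subgroup_type (closureg (imageg hg K))).
Proof.
move=> HQ og tG tM clK hf fi.
have [U [oU cU _]] := van_dantzig tG (@filterT _ _ (nbhs_filter (1 : G))).
have UK x u : K u -> U x -> U x by [].
have KU k u : U u -> K k -> K (k ^ u) by move=> _; exact: normal_subgroupP.
pose O := mulsub KU.
have UO : U `<=` O by move=> u Uu; exists u => //; rewrite mulVg; exact: subg1.
have KO : K `<=` O.
  by move=> k Kk; exists 1; [exact: subg1|rewrite invg1 mul1g].
have oO : open (O : set G).
  by apply: nbhs_subgroup_open; apply: filterS (open_nbhs1 oU).
have eO : elementary (subgroup_type (imageg hg O)).
  apply: (elementary_image_cocompact (U := U) (K := K) (f := f) hg HQ og) => //.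
  - by move=> x y _; exact: normal_subgroupP.
  (* The witness is [x * u^-1], written as a conjugate to show that it lies in [K]; it turns [x] in
     [U K] into [x] in [K U]. *)
  - move=> x [u Uu Kx]; exists ((u^-1 * x) ^ u^-1); first exact: normal_subgroupP.
    suff -> : ((u^-1 * x) ^ u^-1)^-1 * x = u by [].
    by rewrite conjgE invgK mulgA mulVKg invgM invgK mulgVK.
have oI : open (imageg hg O : set M) by exact: og.
apply: elementary_subgroup_sub eO => //; first exact: closed_closure.
rewrite [X in _ `<=` X]((closure_id _).1 (open_subgroup_closed oI)).
by apply: closureS => _ [x Kx <-]; exists x => //; exact: KO.
Qed.

Section Core.
Variables (G Q : topologicalGroupType) (K : normal_subgroup G) (U : subgroup G).
Variable f : subgroup_type K -> Q.
Hypotheses (hf : hom f) (clK : closed (K : set G)) (cU : compact U).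
Hypothesis GKU : forall x, exists2 k, K k & U (k^-1 * x).

(* Preimages under f are normal in K but need not be U-invariant; their U-core
   is normal in G = K U. *)
Definition fcore (A : subgroup Q) : subgroup G :=
  coreg (imageg (hom_emb K) (preimg hf A)) U.

Lemma fcore_emb (A : subgroup Q) x :
  fcore A (emb x) -> A (f x).
Proof. by move=> /coreg_sub [y Ay /emb_inj <-]. Qed.

Lemma fcore_sub (A : subgroup Q) : fcore A `<=` K.
Proof. by move=> x /coreg_sub [y _ <-]; exact: emb_in. Qed.

Lemma fcoreP (A : subgroup Q) x :
  (forall y, (exists2 u, U u & emb y = x ^ u) -> A (f y)) -> K x -> fcore A x.
Proof.
move=> xA Kx u Uu; have [y yx] := emb_surj (normal_subgroupP u Kx).
by exists y => //; apply: xA; exists u.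
Qed.

Lemma fcoreS (A B : subgroup Q) : A `<=` B -> fcore A `<=` fcore B.
Proof. by move=> AB x Ax u Uu; have [y /AB] := Ax u Uu; exists y. Qed.

(** The core is [U]-invariant and [G = K U], so conjugation by [k] in [K] is what remains. There
    [(x ^ k) ^ u = (x ^ u) ^ (k ^ u)], and the preimage of [N] is normal in [K]. *)
Lemma fcore_normal (N : normal_subgroup Q) x g : fcore N x -> fcore N (x ^ g).
Proof.
move=> Nx; have [k Kk Uk] := GKU g.
rewrite -[g](mulVKg k) conjgM; apply: coregJ => // u Uu.
rewrite -conjgM conjgC conjgM.
have [a Na <-] := Nx u Uu.
have [b <-] := emb_surj (normal_subgroupP u Kk).
exists (a ^ b); last exact: (homJ (hom_emb K)).
by rewrite /= (homJ hf); exact: normal_subgroupP.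
Qed.
Definition nfcore N := NormalSubgroup (@fcore_normal N).

Lemma fcore_closed (A : subgroup Q) :
  closed (A : set Q) -> closed (fcore A : set G).
Proof.
move=> clA; apply: coreg_closed.
have : open (~` (f @^-1` A)).
  by apply: closed_openC; exact: (@preimg_closed _ _ f hf A clA).
move=> /emb_open[O oO fO].
have -> : (imageg (hom_emb K) (preimg hf A) : set G) = ~` O `&` K.
  apply/seteqP; split=> [_ [y Ay <-]|x [nOx /emb_surj[y yx]]].
    split; last exact: emb_in.
    by move=> Oy; suff : (~` (f @^-1` A)) y by []; rewrite fO.
  exists y => //; apply: contrapT => nAy.
  by apply: nOx; rewrite -yx; suff : (@emb _ K @^-1` O) y by []; rewrite -fO.
by apply: closedI => //; exact: open_closedC.
Qed.

(** The preimage of [A] is the trace on [K] of an open set of [G], whose core over the compact [U]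
    is still a neighbourhood of 1. *)
Lemma fcore_open (A : subgroup Q) : open (A : set Q) ->
  exists2 Y, nbhs (1 : G) Y & K `&` Y `<=` fcore A.
Proof.
move=> oA; have : open (f @^-1` A) by exact: (@preimg_open _ _ f hf A oA).
move=> /emb_open[O oO fO]; exists (coreg_set O U).
  apply: compact_conj_nbhs => //; apply: open_nbhs_nbhs; split => //.
  rewrite -(hom1 (hom_emb K)); suff : (@emb _ K @^-1` O) 1 by [].
  by rewrite -fO /= (hom1 hf); exact: subg1.
move=> x [Kx Ox]; apply: fcoreP => // y [u Uu yx].
suff : (f @^-1` A) y by [].
by rewrite fO /= yx; exact: Ox.
Qed.

End Core.

(** Let [H] be the core of [N]. The cores [D n] of the open subgroups [V n] are relatively open in
    [K] and decrease to [H], and the quotient of [M] by [L] is an open image of that of [G] by [H].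
    Thus [elementary_image_residually_discrete] applies modulo [H]. *)
Lemma elementary_quotient_residually_discrete (Q G M : topologicalGroupType)
    (g : G -> M) (K : normal_subgroup G) (U : subgroup G)
    (f : subgroup_type K -> Q) (hf : hom f) (N : normal_subgroup Q)
    (L : normal_subgroup M) :
  hom g -> open_map g -> (forall y, exists x, g x = y) ->
  tdlcsc G -> tdlcsc M -> tdlcsc Q -> closed (K : set G) ->
  open (U : set G) -> compact U -> (forall x, exists2 k, K k & U (k^-1 * x)) ->
  closed (N : set Q) -> open (N : set Q) \/ cocompact N ->
  closed (L : set M) -> (forall x, fcore U hf N x -> L (g x)) ->
  elementary (quotient_group L).
Proof.
move=> hg og gs tG tM tQ clK oU cU GKU clN Noc clL HL.
have [V [oV Vdecr NV VN]] := residually_discrete_quotient tQ clN Noc.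
pose H := nfcore hf GKU N; pose D n := nfcore hf GKU (V n).
have clH : closed (H : set G) by exact: fcore_closed.
have HD n : H `<=` D n by exact: fcoreS.
have kH x (A : set G) : H `<=` A -> cmap H x = 1 -> A x.
  by move=> HA /cmap1P; exact: HA.
have DH x : (forall n, D n x) -> H x.
  move=> Dx; apply: fcoreP; last exact: fcore_sub (Dx 0%N).
  move=> y [u Uu yx]; apply: VN => n; apply: (fcore_emb (U := U) (hf := hf)).
  by rewrite yx; exact: coregJ Uu (Dx n).
have hh : hom (cmap L \o g) by apply: hom_comp => //; exact: hom_cmap.
have kg x : H x -> (cmap L \o g) x = 1 by move=> Hx; apply/cmap1P/HL.
have hc := hom_cmap H.
apply: (@elementary_image_residually_discrete _ _ (@qlift _ _ H (cmap L \o g))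
  (imageg hc U) (nimageg hc (@cmap_surj _ H) K)
  (fun n => nimageg hc (@cmap_surj _ H) (D n))).
- exact: hom_qlift.
- apply: qlift_open_map => // A oA; rewrite -image_comp.
  by apply: open_map_cmap; exact: og.
- move=> y; have [z <-] := cmap_surj y; have [x <-] := gs z.
  by exists (cmap H x); rewrite qlift_cmap.
- exact: tdlcsc_quotient.
- exact: tdlcsc_quotient.
- exact: open_map_cmap.
- by apply: compact_image => //; exact: hom_continuous.
- move=> y; have [x <-] := cmap_surj y; have [k Kk Uk] := GKU x.
  exists (cmap H k); first by exists k.
  by exists (k^-1 * x); rewrite // (homM hc) (homV hc).
- move=> n; apply: imageg_closed; first exact: cmap_surj.
  + exact: open_map_cmap.
  + by move=> x; exact: kH.
  + by apply: fcore_closed => //; exact: open_subgroup_closed.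
- by move=> i j ij _ [x Dx <-]; exists x => //; apply: fcoreS Dx; exact: Vdecr.
- by move=> n _ [x Dx <-]; exists x => //; exact: fcore_sub Dx.
- move=> y Dy; have [x xy] := cmap_surj y; rewrite -xy in Dy *.
  apply/cmap1P/DH => n; apply: (imageg_sat (hg := hc)); last exact: Dy.
  by move=> z; exact: kH.
- move=> n; have [Y nY KY] := fcore_open hf cU (oV n).
  exists (@cmap _ H @` Y).
    rewrite -(hom1 hc); exact: pi_quotient_nbhs.
  move=> y [[k Kk <-] [x Yx /esym/cmap_eqP kx]]; exists x; last exact/esym/cmap_eqP.
  apply: KY; split => //; apply: (subgMl (subgV Kk)).
  exact: fcore_sub kx.
Qed.

Theorem elementary_cocompact_quotients (Q : topologicalGroupType) :
  elementary Q -> cocompact_quotients_elementary Q.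
Proof.
move: Q.
(* In the compact and discrete cases, the preceding lemma is used with [N] and [L] trivial. *)
have base Q : tdlcsc Q -> open [set 1 : Q] \/ cocompact [set 1 : Q] ->
    cocompact_quotients_elementary Q.
  move=> tQ Q1 G M g K U f hg og gs tG tM clK oU cU GKU hf fi.
  apply: (@elementary_quotient_extension M (trivg M)) => //.
    exact: elementary_trivg.
  apply: (@elementary_quotient_residually_discrete Q G M g K U f hf (trivg Q)
    (trivg M)) => //; try exact: tdlcsc_closed1.
  move=> x /coreg_sub [y /= y1 <-] /=; rewrite -(hom1 hg) -(hom1 (hom_emb K)).
  by congr (g (emb _)); apply: fi; rewrite y1 (hom1 hf).
apply: elementary_cocompact_ind => Q.
- move=> tQ cQ; apply: base => //; right; exists setT => // x.
  by exists x => //=; rewrite mulVg.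
- by move=> tQ dQ; apply: base => //; left; exact: dQ.
- move=> N tQ clN eN IH Noc G M g K U f hg og gs tG tM clK oU cU GKU hf fi.
  pose H := nfcore hf GKU N.
  have clH : closed (H : set G) by exact: fcore_closed.
  have HK (x : subgroup_type H) : K (emb x) by exact: fcore_sub (emb_in x).
  have HN (x : subgroup_type H) : N (f (lift HK x)).
    by apply: (fcore_emb (U := U) (hf := hf)); rewrite emb_lift; exact: (emb_in x).
  pose L := nclosureg hg gs H.
  (* [H] injects into [N], so the induction hypothesis handles the closure of its image; the rest of
     [M] is residually discrete modulo this closure. *)
  have eL : elementary (subgroup_type L).
    apply: (elementary_closure_image (f := lift HN) hg IH) => //.
    + apply: hom_lift; apply: (hom_comp (f := lift HK)) => //.
      by apply: hom_lift; exact: hom_emb.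
    + apply: lift_inj => x y /fi; apply: lift_inj; exact: emb_inj.
  apply: (elementary_quotient_extension tM eL).
  apply: (@elementary_quotient_residually_discrete Q G M g K U f hf N L) => //.
  + exact: closed_closure.
  + by move=> x Hx; apply: subset_closure; exists x.
- move=> O tQ oO Oincr QO eO IH G M g K U f hg og gs tG tM clK oU cU GKU hf fi.
  have cover C : compact C -> exists i, forall y, C (emb y) -> O i (f y).
    move=> /(compact_emb_preimage clK) cC.
    have [|||i Ci] := @compact_increasing_cover _ _ (fun i => f @^-1` O i) cC.
    + by move=> i j ij x; exact: Oincr.
    + by move=> i; exact: (@preimg_open _ _ f hf (O i) (oO i)).
    + move=> y _; have : [set: Q] (f y) by [].
      by rewrite QO => -[i _ Oi]; exists i.
    + by exists i.
  have [j0 Uj0] := cover U cU.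
  pose D i := fcore U hf (O (i + j0)%N).
  have DU i k u : U u -> D i k -> D i (k ^ u) by exact: coregJ.
  pose R i := mulsub (DU i).
  have UR i : U `<=` R i.
    by move=> u Uu; exists u => //; rewrite mulVg; exact: subg1.
  have oR i : open (R i : set G).
    by apply: nbhs_subgroup_open; apply: filterS (open_nbhs1 oU); exact: UR.
  have DR i : D i `<=` R i.
    by move=> x Dx; exists 1; [exact: subg1|rewrite invg1 mul1g].
  have Dincr i j : (i <= j)%N -> D i `<=` D j.
    by move=> ij; apply: fcoreS; apply: Oincr; rewrite leq_add2r.
  apply: (@elementary_union M (fun i => imageg hg (R i))) => //.
  + by move=> i; exact: og.
  + move=> i j ij _ [x [u Uu Dx] <-]; exists x => //; exists u => //.
    exact: Dincr Dx.
  + apply/seteqP; split=> // y _; have [x <-] := gs y.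
    have [k Kk Uk] := GKU x.
    (* All [U]-conjugates of [k] form a compact subset of [K], which [f] maps into a single [O i];
       hence [k] lies in a [U]-core. *)
    have cC : compact ((fun u => k ^ u) @` U).
      by apply: compact_image => //; exact: conjgr_continuous.
    have [i Oi] := cover _ cC.
    exists i => //; exists x => //; rewrite -[x](mulVKg k).
    apply: subgM; last exact: UR.
    apply/DR/fcoreP => // z [u Uu zk]; apply: Oincr (leq_addr _ _) _ _.
    by apply: Oi; rewrite zk; exists u.
  + move=> i.
    have DK (x : subgroup_type (D i)) : K (emb x) by exact: fcore_sub (emb_in x).
    have DO (x : subgroup_type (D i)) : O (i + j0)%N (f (lift DK x)).
      by apply: (fcore_emb (U := U) (hf := hf)); rewrite emb_lift; exact: (emb_in x).
    apply: (elementary_image_cocompact (K := D i) (U := U) (f := lift DO) hg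
      (IH (i + j0)%N)) => //.
    * apply: fcore_closed => //; apply: open_subgroup_closed; exact: oO.
    * move=> x y [u Uu Dy] Dx; rewrite -[y](mulVKg u) conjgM.
      by apply: subgJ => //; exact: (DU i).
    * move=> x [u Uu Dx]; exists ((u^-1 * x) ^ u^-1).
        by apply: (DU i) => //; exact: subgV.
      suff -> : ((u^-1 * x) ^ u^-1)^-1 * x = u by [].
      by rewrite conjgE invgK mulgA mulVKg invgM invgK mulgVK.
    * apply: hom_lift; apply: (hom_comp (f := lift DK)) => //.
      by apply: hom_lift; exact: hom_emb.
    * apply: lift_inj => x y /fi; apply: lift_inj; exact: emb_inj.
Qed.

(** * Radical and residual *)

(** A maximal member lies below the greatest one and hence equals it. *)
Lemma greatest_unique_maximal (G : topologicalGroupType)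
    (P : normal_subgroup G -> Prop) (R : normal_subgroup G) :
  P R -> (forall N, P N -> N `<=` R) -> exists! R, is_maximal P R.
Proof.
move=> PR maxR; exists R; split.
  split=> // N PN RN; apply: normal_subgroup_eq.
  by apply/seteqP; split=> //; exact: maxR.
by move=> R' [PR' maxR']; apply: maxR' => //; exact: maxR.
Qed.

Lemma least_unique_minimal (G : topologicalGroupType)
    (P : normal_subgroup G -> Prop) (R : normal_subgroup G) :
  P R -> (forall N, P N -> R `<=` N) -> exists! R, is_minimal P R.
Proof.
move=> PR minR; exists R; split.
  split=> // N PN NR; apply: normal_subgroup_eq.
  by apply/seteqP; split=> //; exact: minR.
by move=> R' [PR' minR']; apply: minR' => //; exact: minR.
Qed.

(** * Intersections of subgroups with elementary quotient, and the residual *)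

Section Residual.
Variable G : topologicalGroupType.
Hypothesis tG : tdlcsc G.

Let coelementary (N : normal_subgroup G) :=
  closed (N : set G) /\ elementary (quotient_group N).

Lemma nsubgI_subproof (N1 N2 : normal_subgroup G) x g :
  subgI N1 N2 x -> subgI N1 N2 (x ^ g).
Proof. by move=> [N1x N2x]; split; exact: normal_subgroupP. Qed.
Definition nsubgI N1 N2 := NormalSubgroup (@nsubgI_subproof N1 N2).

(** The quotient by the intersection maps to the quotient by [N1], and the kernel of this map
    injects into the quotient by [N2]. *)
Lemma elementary_quotient_setI (N1 N2 : normal_subgroup G) :
  coelementary N1 -> coelementary N2 -> coelementary (nsubgI N1 N2).
Proof.
move=> [clN1 eN1] [clN2 eN2]; set N := nsubgI N1 N2.
have clN : closed (N : set G) by exact: closedI.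
split=> //; have tQ := tdlcsc_quotient tG clN.
have k1 x : N x -> cmap N1 x = 1 by case=> N1x _; apply/cmap1P.
have k2 x : N x -> cmap N2 x = 1 by case=> _ N2x; apply/cmap1P.
have h1 := hom_qlift (hom_cmap N1) k1; have h2 := hom_qlift (hom_cmap N2) k2.
apply: (elementary_hom_extension (hf := h1)) => //.
apply: (elementary_injective eN2 (f := qlift (cmap N2) \o @emb _ _)).
- apply: tdlcsc_subgroup => //; apply: preimg_closed.
  by apply: tdlcsc_closed1; exact: elementary_tdlcsc.
- by apply: hom_comp => //; exact: hom_emb.
- apply: ker1_inj; first by apply: hom_comp => //; exact: hom_emb.
  move=> y /=; have := emb_in y; have [x xy] := cmap_surj (emb y).
  rewrite /= -xy (qlift_cmap (hom_cmap N1) k1) (qlift_cmap (hom_cmap N2) k2).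
  move=> /cmap1P N1x /cmap1P N2x; apply: emb_inj.
  by rewrite (hom1 (hom_emb _)) -xy; apply/cmap1P.
Qed.

Lemma coelementary_fullg : coelementary (fullg G).
Proof.
split; first exact: closedT.
apply: discrete_elementary; first by apply: tdlcsc_quotient => //; exact: closedT.
by apply: (discrete_quotient (fullg G)).2; exact: openT.
Qed.

End Residual.

(** [G] is exhausted by the normalisers [O n] of the intersections of [N n] with [U]. Each maps to
    the quotient by [N n], and that intersection is compact, open and normal in the kernel. *)
Lemma elementary_residual (G : topologicalGroupType)
    (N : nat -> normal_subgroup G) :
  tdlcsc G -> (forall n, closed (N n : set G)) ->
  (forall n, elementary (quotient_group (N n))) ->
  (forall i j, (i <= j)%N -> N j `<=` N i) ->
  (forall x, (forall n, N n x) -> x = 1) -> elementary G.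
Proof.
move=> tG clN eN Ndecr N1; have [hG _ _ _] := tG.
have [U [oU cU _]] := van_dantzig tG (@filterT _ _ (nbhs_filter (1 : G))).
have Nn n x t : N n x -> N n (x ^ t) by exact: normal_subgroupP.
have [oO Oincr GO] := normalizer_exhaustion hG oU cU Nn clN Ndecr N1.
pose O n := normg (N n `&` U).
apply: (@elementary_union G O) => //.
  by apply/seteqP; split=> // t _; have [n On] := GO t; exists n.
move=> n; have clO := open_subgroup_closed (oO n).
have clU := open_subgroup_closed oU.
have hf : hom (cmap (N n) \o @emb _ (O n)).
  by apply: hom_comp; [exact: hom_emb|exact: hom_cmap].
apply: (elementary_hom_extension (hf := hf) (eN n)); first exact: tdlcsc_subgroup.
suff -> : normal_subgroup_sub (npreimg hf (trivg (quotient_group (N n)))) =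
    preimg (hom_emb (O n)) (subgI (O n) (N n)).
  apply: (@elementary_iso (subgroup_type (subgI (O n) (N n)))); last first.
    by apply: iso_nested => x [].
  apply: (@elementary_compact_by_discrete _ _ (subgI (N n) U) U) => //.
  - exact: closedI.
  - exact: closedI.
  - by rewrite /= setIC; apply: compact_closedI.
  - move=> x [Nx Ux]; split=> //; move: x Ux {Nx}; apply: normgP => a x Ux [Na Ua].
    by split; [exact: Nn|exact: subgJ].
  - by move=> x h [Oh _] Nx; exact: (Oh x Nx).1.
  - exact: subg1.
  - by move=> x [[_ Nx] Ux].
apply: subgroup_eq; apply/seteqP; split=> x /=.
  by move=> /cmap1P Nx; split=> //; exact: (@emb_in _ (O n) x).
by move=> [_ Nx]; apply/cmap1P.
Qed.

Lemma elementary_quotient_bigcap (G : topologicalGroupType)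
    (N : nat -> normal_subgroup G) (R : normal_subgroup G) :
  tdlcsc G -> (forall n, closed (N n : set G)) ->
  (forall n, elementary (quotient_group (N n))) ->
  (forall i j, (i <= j)%N -> N j `<=` N i) ->
  (R : set G) = \bigcap_n N n -> elementary (quotient_group R).
Proof.
move=> tG clN eN Ndecr RE.
have clR : closed (R : set G) by rewrite RE; exact: closed_bigI.
have tR := tdlcsc_quotient tG clR; have hc := hom_cmap R.
have RN n : R `<=` N n by rewrite RE => x; exact.
have kN n x : cmap R x = 1 -> N n x by move=> /cmap1P; exact: RN.
pose D n := nimageg hc (@cmap_surj _ R) (N n).
have clD n : closed (D n : set (quotient_group R)).
  apply: imageg_closed => //; first exact: cmap_surj.
  - exact: open_map_cmap.
  - exact: kN.
have satD n x : D n (cmap R x) -> N n x by apply: imageg_sat; exact: kN.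
apply: (@elementary_residual _ D) => //.
- move=> n.
  have kR x : R x -> cmap (N n) x = 1 by move=> Rx; apply/cmap1P/RN.
  have h1 := hom_qlift (hom_cmap (N n)) kR.
  have kD y : D n y -> qlift (cmap (N n)) y = 1.
    by move=> [x Nx <-]; rewrite (qlift_cmap (hom_cmap (N n)) kR); apply/cmap1P.
  apply: (elementary_injective (eN n) _ (hom_qlift h1 kD)).
    exact: tdlcsc_quotient.
  apply: qlift_inj => // y; have [x <-] := cmap_surj y.
  by rewrite (qlift_cmap (hom_cmap (N n)) kR) => /cmap1P Nx; exists x.
- by move=> i j ij _ [x Nx <-]; exists x => //; exact: Ndecr Nx.
- move=> y; have [x <-] := cmap_surj y => Dx; apply/cmap1P.
  by rewrite RE => n _; exact: satD.
Qed.

(** For each basic open set, [N n] is chosen to miss it if some candidate does, with [G] as default.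
    The intersection of the [N n] is the least candidate: a point outside a candidate [N'] has a
    basic neighbourhood missing [N'], hence missing the chosen [N n]. *)
Theorem least_coelementary (G : topologicalGroupType) : tdlcsc G ->
  exists R : normal_subgroup G,
    (closed (R : set G) /\ elementary (quotient_group R)) /\
    forall N : normal_subgroup G,
      closed (N : set G) /\ elementary (quotient_group N) -> R `<=` N.
Proof.
move=> tG; have [_ _ _ /second_countable_seq[b [bop bbase]]] := tG.
pose P (N : normal_subgroup G) :=
  closed (N : set G) /\ elementary (quotient_group N).
have exN n : exists N, P N /\
    ((exists2 N', P N' & b n `&` N' = set0) -> b n `&` N = set0).
  have [[N PN bN]|nex] := pselect (exists2 N', P N' & b n `&` N' = set0).
    by exists N.
  by exists (fullg G); split=> //; exact: coelementary_fullg.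
have [N NP] := choice exN.
pose D := fix D n := if n is m.+1 then nsubgI (D m) (N n) else N 0%N.
have PD n : P (D n).
  elim: n => [|n IH] /=; first exact: (NP _).1.
  by apply: elementary_quotient_setI => //; exact: (NP _).1.
have DN n : D n `<=` N n by case: n => [|n] //= x [].
have Ddecr i j : (i <= j)%N -> D j `<=` D i.
  elim: j => [|j IH]; first by rewrite leqn0 => /eqP ->.
  rewrite leq_eqVlt => /predU1P[-> //|/IH DD].
  by move=> x [/DD].
have Rsub : is_subgroup (\bigcap_n D n).
  split=> [n _|x y Dx Dy n _|x Dx n _]; first exact: subg1.
  - by apply: subgM; [exact: Dx|exact: Dy].
  - by apply: subgV; exact: Dx.
have Rnormal x g : Subgroup Rsub x -> Subgroup Rsub (x ^ g).
  by move=> Dx n _; apply: normal_subgroupP; exact: Dx.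
exists (NormalSubgroup Rnormal); split.
  split; first by apply: closed_bigI => n _; exact: (PD n).1.
  by apply: (elementary_quotient_bigcap tG (N := D)) => // n; case: (PD n).
move=> N' [clN' eN'] x Rx; apply: contrapT => nN'x.
have [n [bx bN']] := bbase x (~` N')
  (open_nbhs_nbhs (conj (closed_openC clN') nN'x)).
have bN : b n `&` N n = set0.
  apply: (NP n).2; exists N' => //.
  by apply/seteqP; split=> // z [/bN'].
by have : (b n `&` N n) x; [split=> //; exact: DN (Rx n I)|rewrite bN].
Qed.

(** * Joins and increasing unions of elementary normal subgroups, and the radical *)

Section Join.
Variables (G : topologicalGroupType) (N1 N2 : normal_subgroup G).

(** The closure of [N1 N2], presented as a preimage so that it is visibly an extension of [N1] by a
    closure of an image of [N2]. *)
Definition njoin : normal_subgroup G :=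
  npreimg (hom_cmap N1) (nclosureg (hom_cmap N1) (@cmap_surj _ N1) N2).

Lemma njoin_closed : closed (njoin : set G).
Proof. by apply: preimg_closed; exact: closed_closure. Qed.

Lemma njoinl : N1 `<=` njoin.
Proof. by move=> x /cmap1P /= ->; exact: (subg1 (closureg (imageg (hom_cmap N1) N2))). Qed.

Lemma njoinr : N2 `<=` njoin.
Proof. by move=> x N2x; apply: subset_closure; exists x. Qed.

Lemma elementary_njoin : tdlcsc G ->
  closed (N1 : set G) -> elementary (subgroup_type N1) ->
  closed (N2 : set G) -> elementary (subgroup_type N2) ->
  elementary (subgroup_type njoin).
Proof.
move=> tG clN1 eN1 clN2 eN2; pose hc := hom_cmap N1.
have eL : elementary (subgroup_type (closureg (imageg hc N2))).
  apply: (elementary_closure_image (f := @id (subgroup_type N2)) hc) => //.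
  - exact: elementary_cocompact_quotients.
  - exact: open_map_cmap.
  - exact: tdlcsc_quotient.
  - exact: hom_id.
apply: (elementary_hom_extension (hf := hom_resg hc _) eL).
  by apply: tdlcsc_subgroup => //; exact: njoin_closed.
apply: elementary_ker_resg.
suff -> : npreimg hc (trivg _) = N1 by [].
by apply: normal_subgroup_eq; apply/seteqP; split=> x /cmap1P.
Qed.

End Join.

Section IncreasingUnion.
Variables (G : topologicalGroupType) (N : nat -> subgroup G).
Hypothesis Nincr : forall i j, (i <= j)%N -> N i `<=` N j.

Lemma bigcupg_subproof : is_subgroup (\bigcup_n N n).
Proof.
split=> [|x y [i _ Nx] [j _ Ny]|x [i _ Nx]].
- by exists 0%N => //; exact: subg1.
- exists (maxn i j) => //; apply: subgM.
    by apply: Nincr Nx; exact: leq_maxl.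
  by apply: Nincr Ny; exact: leq_maxr.
- by exists i => //; exact: subgV.
Qed.
Definition bigcupg := Subgroup bigcupg_subproof.

End IncreasingUnion.

(** Each [N n U] is open, and elementary because [N n] is cocompact in it. Their increasing union is
    open, hence closed, and so contains the closure in question. *)
Lemma elementary_closure_bigcup (G : topologicalGroupType)
    (N : nat -> normal_subgroup G)
    (Nincr : forall i j, (i <= j)%N -> N i `<=` N j) :
  tdlcsc G -> (forall n, closed (N n : set G)) ->
  (forall n, elementary (subgroup_type (N n))) ->
  elementary (subgroup_type (closureg (bigcupg Nincr))).
Proof.
move=> tG clN eN.
have [U [oU cU _]] := van_dantzig tG (@filterT _ _ (nbhs_filter (1 : G))).
have NU n k u : U u -> N n k -> N n (k ^ u).
  by move=> _; exact: normal_subgroupP.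
pose O n := mulsub (NU n).
have UO n : U `<=` O n.
  by move=> u Uu; exists u => //; rewrite mulVg; exact: subg1.
have oO n : open (O n : set G).
  by apply: nbhs_subgroup_open; apply: filterS (open_nbhs1 oU); exact: UO.
have NO n : N n `<=` O n.
  by move=> x Nx; exists 1; [exact: subg1|rewrite invg1 mul1g].
have Oincr i j : (i <= j)%N -> O i `<=` O j.
  by move=> ij x [u Uu Nx]; exists u => //; exact: Nincr Nx.
have eO n : elementary (subgroup_type (O n)).
  apply: (@elementary_subgroup_ext _ _ (N n)) => //.
  - exact: open_subgroup_closed.
  - by move=> x h _; exact: normal_subgroupP.
  - right; exists (U : set G) => // x [u Uu Nx]; exists u => //.
    by split=> //; exact: UO.
have oH : open (bigcupg Oincr : set G) by apply: bigcup_open => n _.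
apply: (@elementary_subgroup_sub _ (bigcupg Oincr)) => //.
- exact: closed_closure.
- rewrite [X in _ `<=` X]((closure_id _).1 (open_subgroup_closed oH)).
  by apply: closureS => x [n _ /NO Ox]; exists n.
- exact: (@elementary_subgroup_union _ _ O).
Qed.

(** Dually to the residual, [N n] is chosen to meet the basic set [b n] if some candidate does.
    Every neighbourhood of a point of a candidate then meets some [N n], so the closure of the union
    of the successive joins contains that candidate. *)
Theorem greatest_elementary (G : topologicalGroupType) : tdlcsc G ->
  exists R : normal_subgroup G,
    (closed (R : set G) /\ elementary (subgroup_type R)) /\
    forall N : normal_subgroup G,
      closed (N : set G) /\ elementary (subgroup_type N) -> N `<=` R.
Proof.
move=> tG; have [_ _ _ /second_countable_seq[b [bop bbase]]] := tG.
pose P (N : normal_subgroup G) :=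
  closed (N : set G) /\ elementary (subgroup_type N).
have exN n : exists N, P N /\
    ((exists2 N', P N' & b n `&` N' !=set0) -> b n `&` N !=set0).
  have [[N PN bN]|nex] := pselect (exists2 N', P N' & b n `&` N' !=set0).
    by exists N.
  exists (trivg G); split=> //.
  by split; [exact: tdlcsc_closed1|exact: elementary_trivg].
have [N NP] := choice exN.
pose D := fix D n := if n is m.+1 then njoin (D m) (N n) else N 0%N.
have PD n : P (D n).
  elim: n => [|n [clD eD]] /=; first exact: (NP _).1.
  have [clN eN] := (NP n.+1).1.
  by split; [exact: njoin_closed|exact: elementary_njoin].
have ND n : N n `<=` D n by case: n => [|n] //=; exact: njoinr.
have Dincr i j : (i <= j)%N -> D i `<=` D j.
  elim: j => [|j IH]; first by rewrite leqn0 => /eqP ->.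
  rewrite leq_eqVlt => /predU1P[-> //|/IH DD].
  by apply: subset_trans DD _; exact: njoinl.
have Rnormal x g : closureg (bigcupg Dincr) x ->
    closureg (bigcupg Dincr) (x ^ g).
  move=> clx W /(nbhs_preimage (@conjgl_continuous _ g)) /clx [a [[n _ Da] Wa]].
  by exists (a ^ g); split=> //; exists n => //; exact: normal_subgroupP.
exists (NormalSubgroup Rnormal); split.
  split; first exact: closed_closure.
  by apply: elementary_closure_bigcup => // n; case: (PD n).
move=> N' PN' x N'x W /bbase [n [bx bW]].
have [|y [by_ Ny]] := (NP n).2; first by exists N' => //; exists x.
by exists y; split; [exists n => //; exact: ND|exact: bW].
Qed.

Theorem theorem1p5 (G : topologicalGroupType) (hG : tdlcsc G) :
  (exists! R : normal_subgroup G,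
     is_maximal (fun N : normal_subgroup G =>
       closed (N : set G) /\ elementary (subgroup_type N)) R) /\
  (exists! R : normal_subgroup G,
     is_minimal (fun N : normal_subgroup G =>
       closed (N : set G) /\ elementary (quotient_group N)) R).
Proof.
split.
- have [R [PR maxR]] := greatest_elementary hG.
  exact: greatest_unique_maximal PR maxR.
- have [R [PR minR]] := least_coelementary hG.
  exact: least_unique_minimal PR minR.
Qed.
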